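(* Let $m\in\mathbb Z$ with $|m|\ge2$ and let $Z_m^\times=\{\overline{BS}(m,\xi):\xi\in\mathbb Z_m^\times\}\subseteq\mathcal G_2$. Then the Hausdorff dimension of $Z_m^\times$ with respect to the metric of $\mathcal G_2$ satisfies $$\frac{\log|m|}{2(|m|+1)}\le\dim_H(Z_m^\times)\le\frac{\log|m|}{2}.$$
   Context: $\mathbb Z_m$ is the ring of $m$-adic integers and $\mathbb Z_m^\times$ its group of units. For $p,q\in\mathbb Z\setminus\{0\}$, $BS(p,q)=\langle a,b\mid ab^pa^{-1}=b^q\rangle$, marked by $(a,b)$. $\mathcal G_2$ is the space of marked groups on two generators, i.e. normal subgroups of $\mathbb F(a,b)$, with the ultrametric $d(N_1,N_2)=e^{-\lambda}$ ($N_1\ne N_2$), $\lambda$ the minimal word length of an element of $N_1\triangle N_2$. $\overline{BS}(m,\xi)$ is the limit in $\mathcal G_2$ of $BS(m,\xi_n)$ for any sequence of integers $(\xi_n)$ with $|\xi_n|\to\infty$, $\xi_n\to\xi$ in $\mathbb Z_m$ (exists, independent of the sequence). $\log$ is the natural logarithm. *)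

(* Defs.v *)
From Stdlib Require Import Reals ZArith List Classical ClassicalEpsilon.
Import ListNotations.
Open Scope R_scope.

(* A letter is (generator, sign): generator false = a, true = b;
   sign true = positive power, false = inverse. *)
Definition letter := (bool * bool)%type.
Definition word := list letter.

Definition letter_inv (l : letter) : letter := (fst l, negb (snd l)).

Definition is_inv_pair (l l' : letter) : bool :=
  Bool.eqb (fst l) (fst l') && negb (Bool.eqb (snd l) (snd l')).

Fixpoint reduced (w : word) : bool :=
  match w with
  | [] => true
  | l :: w' =>
      match w' with
      | [] => true
      | l' :: _ => negb (is_inv_pair l l') && reduced w'
      end
  end.

Definition cons_red (l : letter) (w : word) : word :=
  match w with
  | l' :: w' => if is_inv_pair l l' then w' else l :: w
  | [] => [l]
  end.

Definition reduce (w : word) : word := fold_right cons_red [] w.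

Definition fmul (u v : word) : word := reduce (u ++ v).
Definition finv (u : word) : word := rev (map letter_inv u).

Definition wlen (w : word) : nat := length w.

(** * Marked groups on two generators = normal subgroups of F(a,b) *)
Definition IsNormalSub (N : word -> Prop) : Prop :=
  (forall w, N w -> reduced w = true) /\
  N [] /\
  (forall u v, N u -> N v -> N (fmul u v)) /\
  (forall u, N u -> N (finv u)) /\
  (forall g u, reduced g = true -> N u -> N (fmul (fmul g u) (finv g))).

Definition G2 := { N : word -> Prop | IsNormalSub N }.

Definition symdiff (N1 N2 : word -> Prop) (w : word) : Prop :=
  reduced w = true /\ ~ (N1 w <-> N2 w).

Definition mdist (N1 N2 : word -> Prop) : R :=
  epsilon (inhabits 0%R) (fun r =>
    ((forall w, ~ symdiff N1 N2 w) /\ r = 0) \/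
    (exists w, symdiff N1 N2 w /\ r = exp (- INR (wlen w)) /\
       forall w', symdiff N1 N2 w' -> (wlen w <= wlen w')%nat)).

Definition G2dist (x y : G2) : R := mdist (proj1_sig x) (proj1_sig y).

Definition bpow (z : Z) : word :=
  if (0 <=? z)%Z then repeat (true, true) (Z.to_nat z)
  else repeat (true, false) (Z.to_nat (- z)).

Definition bs_relator (p q : Z) : word :=
  reduce ((false, true) :: bpow p ++ [(false, false)] ++ bpow (- q)).

Definition normal_closure (r : word) (w : word) : Prop :=
  forall N, IsNormalSub N -> N r -> N w.

(* BS(p,q) marked by (a,b), as a normal subgroup of F(a,b) *)
Definition BS (p q : Z) : word -> Prop := normal_closure (bs_relator p q).

Definition madic (m : Z) (x : nat -> Z) : Prop :=
  forall k : nat,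
    (0 <= x k < Z.abs m ^ Z.of_nat k)%Z /\
    Z.modulo (x (S k)) (Z.abs m ^ Z.of_nat k) = x k.

Definition madic_unit (m : Z) (x : nat -> Z) : Prop :=
  exists y, madic m y /\
    forall k : nat, Z.modulo (x k * y k) (Z.abs m ^ Z.of_nat k)
                    = Z.modulo 1 (Z.abs m ^ Z.of_nat k).

Definition madic_conv (m : Z) (xi : nat -> Z) (x : nat -> Z) : Prop :=
  forall k : nat, exists n0 : nat, forall n : nat, (n0 <= n)%nat ->
    Z.modulo (xi n) (Z.abs m ^ Z.of_nat k) = x k.

Definition Zabs_to_infty (xi : nat -> Z) : Prop :=
  forall M : Z, exists n0 : nat, forall n : nat, (n0 <= n)%nat -> (M <= Z.abs (xi n))%Z.

Definition G2_limit (Ns : nat -> word -> Prop) (N : G2) : Prop :=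
  forall eps : R, eps > 0 -> exists n0 : nat, forall n : nat, (n0 <= n)%nat ->
    mdist (Ns n) (proj1_sig N) < eps.

Definition BSbar (m : Z) (x : nat -> Z) (N : G2) : Prop :=
  forall xi : nat -> Z, Zabs_to_infty xi -> madic_conv m xi x ->
    G2_limit (fun n => BS m (xi n)) N.

Definition Zmx (m : Z) (N : G2) : Prop :=
  exists x, madic m x /\ madic_unit m x /\ BSbar m x N.

Section Hausdorff.
Variable X : Type.
Variable d : X -> X -> R.

Definition diam (U : X -> Prop) : R :=
  epsilon (inhabits 0%R) (fun r =>
    (~ (exists x, U x) /\ r = 0) \/
    is_lub (fun t => exists x y, U x /\ U y /\ t = d x y) r).

Definition powd (r s : R) : R :=
  if Req_EM_T r 0 then (if Req_EM_T s 0 then 1 else 0) else Rpower r s.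

Definition cover_term (U : X -> Prop) (s : R) : R :=
  if excluded_middle_informative (exists x, U x) then powd (diam U) s else 0.

(* H^s(A) = 0, i.e. for every delta > 0, H^s_delta(A) = 0 *)
Definition Hnull (s : R) (A : X -> Prop) : Prop :=
  forall delta eps : R, delta > 0 -> eps > 0 ->
    exists U : nat -> X -> Prop,
      (forall x, A x -> exists i, U i x) /\
      (forall i, diam (U i) <= delta) /\
      (forall n, sum_f_R0 (fun i => cover_term (U i) s) n <= eps).

Definition HausdorffDim (A : X -> Prop) (D : R) : Prop :=
  (forall s, 0 <= s -> Hnull s A -> D <= s) /\
  (forall D', (forall s, 0 <= s -> Hnull s A -> D' <= s) -> D' <= D).
End Hausdorff.

(* Main.v *)
(* BS(m, x) acts on normal forms b^e a^s1 b^r1 ... a^sn b^rn by left multiplication,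
   and a word is a relation iff it fixes the trivial normal form (Britton's lemma).
   Exponents of b met while computing are combinations of 1 and of the iterates
   E_0 = x, E_(i+1) = x * floor(E_i / m); since residues modulo x are chosen centred,
   for |x| large the computation is formal in the E_i and depends on x only through the
   digits E_i mod m. A relation contains as many a as a^-1, so a word of length at
   most 2k + 1 only sees digits determined by x modulo m^k: this gives convergence, distance
   at most e^(-2k) between points congruent modulo m^k, and the upper bound.
   Conversely the digits determine a unit x, and the word
   t = a (... a (a b^m a^-1) b^-r_0 a^-1 ...) b^-r_j a^-1 commutes with b iff r_j is the right
   digit. As [t, b] has length 2(|m|+1) per digit up to a constant, sets of small
   diameter lie in residue classes of controlled measure, and covering the units
   congruent to 1 modulo m forces the lower bound. *)
Require Import Defs.
From Stdlib Require Import Reals ZArith List Bool Lia Lra Classical ClassicalEpsilon.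
From Stdlib Require Import Setoid Morphisms.
Import ListNotations.
Open Scope R_scope.

(** * Free reduction *)

Lemma is_inv_pair_iff l l' : is_inv_pair l l' = true <-> l' = letter_inv l.
Proof.
  destruct l as [[] []], l' as [[] []]; vm_compute; split; congruence.
Qed.

Lemma letter_inv_involutive l : letter_inv (letter_inv l) = l.
Proof. now destruct l as [[] []]. Qed.

Lemma reduced_tail l w : reduced (l :: w) = true -> reduced w = true.
Proof.
  destruct w as [|l' w]; [reflexivity|].
  cbn. now intros [_ H]%andb_true_iff.
Qed.

Lemma reduced_cons_red l w : reduced w = true -> reduced (cons_red l w) = true.
Proof.
  destruct w as [|l' w]; [reflexivity|]. intros H. cbn [cons_red].
  destruct (is_inv_pair l l') eqn:E.
  - now apply reduced_tail in H.
  - cbn [reduced] in *. rewrite E. exact H.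
Qed.

Lemma reduced_reduce w : reduced (reduce w) = true.
Proof. induction w as [|l w IH]; [reflexivity|]. now apply reduced_cons_red. Qed.

Lemma cons_red_reduced l w : reduced (l :: w) = true -> cons_red l w = l :: w.
Proof.
  destruct w as [|l' w]; [reflexivity|]. cbn.
  now destruct (is_inv_pair l l').
Qed.

Lemma reduce_reduced w : reduced w = true -> reduce w = w.
Proof.
  induction w as [|l w IH]; [reflexivity|]. intros H. cbn.
  unfold reduce in IH. rewrite IH by now apply reduced_tail in H.
  now apply cons_red_reduced.
Qed.

Lemma cons_red_cancel l w : reduced w = true -> cons_red l (cons_red (letter_inv l) w) = w.
Proof.
  intros H. destruct w as [|l' w].
  - cbn. now rewrite (proj2 (is_inv_pair_iff l _) eq_refl).
  - cbn [cons_red]. destruct (is_inv_pair (letter_inv l) l') eqn:E.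
    + apply is_inv_pair_iff in E. rewrite letter_inv_involutive in E. subst l'.
      now apply cons_red_reduced.
    + cbn. now rewrite (proj2 (is_inv_pair_iff l _) eq_refl).
Qed.

Lemma fold_right_ok {X} (f : letter -> X -> X) (ok : X -> Prop)
  (f_ok : forall l x, ok x -> ok (f l x)) w x : ok x -> ok (fold_right f x w).
Proof. intros Hx. induction w; cbn; auto. Qed.

(** A letterwise action in which inverse letters cancel on an invariant set factors through the free
    group. It is applied to [cons_red] itself, to the action on normal forms and to the exponent
    sum. *)
Lemma fold_right_reduce {X} (f : letter -> X -> X) (ok : X -> Prop)
  (f_ok : forall l x, ok x -> ok (f l x))
  (f_cancel : forall l x, ok x -> f l (f (letter_inv l) x) = x) w x :
  ok x -> fold_right f x (reduce w) = fold_right f x w.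
Proof.
  intros Hx. induction w as [|l w IH]; [reflexivity|].
  cbn. rewrite <- IH. unfold reduce. set (u := fold_right cons_red [] w).
  destruct u as [|l' u]; [reflexivity|]. cbn [cons_red].
  destruct (is_inv_pair l l') eqn:E; [|reflexivity].
  apply is_inv_pair_iff in E. subst l'. cbn.
  symmetry. apply f_cancel. now apply fold_right_ok.
Qed.

Lemma fold_right_finv {X} (f : letter -> X -> X) (ok : X -> Prop)
  (f_ok : forall l x, ok x -> ok (f l x))
  (f_cancel : forall l x, ok x -> f l (f (letter_inv l) x) = x) w x :
  ok x -> fold_right f (fold_right f x (finv w)) w = x.
Proof.
  revert x. induction w as [|l w IH]; intros x Hx; [reflexivity|].
  unfold finv. cbn. rewrite fold_right_app. cbn.
  change (rev (map letter_inv w)) with (finv w).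
  rewrite IH by now apply f_ok. now apply f_cancel.
Qed.

Lemma reduce_app u v : reduce (u ++ v) = fold_right cons_red (reduce v) u.
Proof. apply fold_right_app. Qed.

Lemma reduce_app_l u v : reduce (reduce u ++ v) = reduce (u ++ v).
Proof.
  rewrite !reduce_app.
  apply (fold_right_reduce cons_red (fun w => reduced w = true)).
  - intros; now apply reduced_cons_red.
  - intros; now apply cons_red_cancel.
  - apply reduced_reduce.
Qed.

Lemma reduce_app_r u v : reduce (u ++ reduce v) = reduce (u ++ v).
Proof. rewrite !reduce_app. now rewrite (reduce_reduced (reduce v)) by apply reduced_reduce. Qed.

Lemma reduce_finv u v : reduce (u ++ finv u ++ v) = reduce v.
Proof.
  rewrite !reduce_app.
  apply (fold_right_finv cons_red (fun w => reduced w = true)).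
  - intros; now apply reduced_cons_red.
  - intros; now apply cons_red_cancel.
  - apply reduced_reduce.
Qed.

Lemma finv_involutive u : finv (finv u) = u.
Proof.
  unfold finv. rewrite map_rev, rev_involutive, map_map.
  rewrite (map_ext _ (fun l => l)) by apply letter_inv_involutive. apply map_id.
Qed.

Lemma reduce_finv_l u v : reduce (finv u ++ u ++ v) = reduce v.
Proof. rewrite <- (finv_involutive u) at 2. apply reduce_finv. Qed.

Lemma finv_app u v : finv (u ++ v) = finv v ++ finv u.
Proof. unfold finv. now rewrite map_app, rev_app_distr. Qed.

Lemma reduced_iff w : reduced w = true <-> forall u l v, w <> u ++ l :: letter_inv l :: v.
Proof.
  split.
  - intros H u l v ->. induction u as [|l' u IH].
    + cbn in H. now rewrite (proj2 (is_inv_pair_iff l _) eq_refl) in H.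
    + apply IH. now apply reduced_tail in H.
  - induction w as [|l w IH]; [reflexivity|]. intros H.
    assert (Hw : reduced w = true).
    { apply IH. intros u l' v ->. now apply (H (l :: u) l' v). }
    destruct w as [|l' w]; [reflexivity|]. cbn [reduced] in *. rewrite Hw.
    destruct (is_inv_pair l l') eqn:E; [|reflexivity].
    apply is_inv_pair_iff in E. subst. now destruct (H [] l w).
Qed.

Lemma reduced_finv w : reduced w = true -> reduced (finv w) = true.
Proof.
  rewrite !reduced_iff. intros H u l v E.
  apply (H (finv v) l (finv u)).
  rewrite <- (finv_involutive w), E, finv_app. unfold finv. cbn.
  rewrite letter_inv_involutive, <- !app_assoc. reflexivity.
Qed.

Lemma length_reduce w : (length (reduce w) <= length w)%nat.
Proof.
  induction w as [|l w IH]; [reflexivity|]. cbn. unfold reduce in IH.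
  destruct (fold_right cons_red [] w) as [|l' u]; cbn in *; [lia|].
  destruct (is_inv_pair l l'); cbn; lia.
Qed.

Lemma reduce_app_mid u v y : reduce (u ++ reduce v ++ y) = reduce (u ++ v ++ y).
Proof. rewrite <- reduce_app_r, reduce_app_l. apply reduce_app_r. Qed.

(** Insert [u ++ finv u] before [v] and reduce that [u]: it then cancels against
    [finv (reduce u)]. *)
Lemma reduce_finv_reduce u v : reduce (finv (reduce u) ++ v) = reduce (finv u ++ v).
Proof.
  rewrite <- reduce_app_r, <- (reduce_finv u v), reduce_app_r, <- reduce_app_mid.
  apply reduce_finv_l.
Qed.

(* Two words are identified when they are interchangeable in every context;
   this is a congruence by construction. *)
Definition cong (N : word -> Prop) (u v : word) : Prop :=
  forall x y, N (reduce (x ++ u ++ y)) <-> N (reduce (x ++ v ++ y)).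

Lemma cong_refl N u : cong N u u.
Proof. intros x y. reflexivity. Qed.

Lemma cong_sym N u v : cong N u v -> cong N v u.
Proof. intros H x y. symmetry. apply H. Qed.

Lemma cong_trans N u v w : cong N u v -> cong N v w -> cong N u w.
Proof. intros H1 H2 x y. now rewrite (H1 x y). Qed.

Lemma cong_app N u u' v v' : cong N u u' -> cong N v v' -> cong N (u ++ v) (u' ++ v').
Proof.
  intros H1 H2 x y. rewrite <- !app_assoc, (H1 x (v ++ y)).
  rewrite !(app_assoc x). apply H2.
Qed.

Lemma cong_cons N l v v' : cong N v v' -> cong N (l :: v) (l :: v').
Proof. apply (cong_app N [l] [l]), cong_refl. Qed.

Lemma cong_finv N u : cong N (u ++ finv u) [].
Proof.
  intros x y. rewrite <- !app_assoc, !(reduce_app x), reduce_finv. reflexivity.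
Qed.

(** Since $x r y = (x r x^{-1}) x y$, deleting [r] inside a word only removes a factor that is a
    conjugate of [r], and normality puts that factor in [N]. *)
Lemma cong_of_mem N r : IsNormalSub N -> N (reduce r) -> cong N r [].
Proof.
  intros (_ & _ & Hmul & Hinv & Hconj) Hr x y. cbn.
  assert (Hc : N (reduce (x ++ r ++ finv x))).
  { pose proof (Hconj (reduce x) (reduce r) (reduced_reduce x) Hr) as H.
    unfold fmul in H. rewrite reduce_app_l, <- !app_assoc, reduce_app_l in H.
    rewrite reduce_app_mid in H. rewrite <- (app_nil_r (finv (reduce x))) in H.
    rewrite app_assoc, <- reduce_app_r, reduce_finv_reduce, reduce_app_r in H.
    now rewrite app_nil_r, <- app_assoc in H. }
  assert (E : forall z, reduce ((x ++ r ++ finv x) ++ x ++ z) = reduce (x ++ r ++ z)).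
  { intros z. rewrite <- !app_assoc.
    now rewrite !(reduce_app x), !(reduce_app r), reduce_finv_l. }
  split; intros H.
  - pose proof (Hmul _ _ (Hinv _ Hc) H) as H'. unfold fmul in H'.
    rewrite <- (E y), reduce_app_r, reduce_finv_reduce in H'.
    now rewrite reduce_finv_l in H'.
  - pose proof (Hmul _ _ Hc H) as H'. unfold fmul in H'.
    now rewrite reduce_app_l, reduce_app_r, E in H'.
Qed.

(** * Normal forms in BS(m, x) *)

Definition state := (Z * list (bool * Z))%type.

Definition modulus (m x : Z) (s : bool) : Z := if s then m else x.

(* The remainder modulo [x] is centred, so that integers small with respect to [x] are
   their own remainders. *)
Definition quo (m x : Z) (s : bool) (e : Z) : Z :=
  ((e + if s then 0 else x / 2) / modulus m x s)%Z.

Definition rmd (m x : Z) (s : bool) (e : Z) : Z := (e - modulus m x s * quo m x s e)%Z.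

(* Multiplies [a^s b^r] into the stack: either the pair [a^s a^-s] is pinched off,
   releasing a power of [b], or [(s, r)] is pushed. *)
Definition hop (s : bool) (r : Z) (L : list (bool * Z)) : state :=
  match L with
  | (s', r') :: L' =>
      if ((r =? 0)%Z && Bool.eqb s' (negb s))%bool then (r', L') else (0%Z, (s, r) :: L)
  | [] => (0%Z, [(s, r)])
  end.

(* The state [(e, [(s1, r1); ...; (sn, rn)])] is the element
   [b^e a^s1 b^r1 ... a^sn b^rn] of BS(m, x), and [act] is left multiplication. *)
Definition act (m x : Z) (l : letter) (st : state) : state :=
  let (e, L) := st in
  let (g, s) := l in
  if g then ((if s then e + 1 else e - 1)%Z, L)
  else let h := hop s (rmd m x s e) L in
       ((modulus m x (negb s) * quo m x s e + fst h)%Z, snd h).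

Definition actw (m x : Z) (w : word) (st : state) : state := fold_right (act m x) st w.

Definition raise (z : Z) (st : state) : state := ((fst st + z)%Z, snd st).

(** The normal form conditions: each exponent is its own remainder and no pinch is left. They are
    what makes inverse letters cancel in the action. *)
Fixpoint wf (m x : Z) (L : list (bool * Z)) : Prop :=
  match L with
  | [] => True
  | (s, r) :: L' =>
      quo m x s r = 0%Z /\
      (r = 0%Z -> match L' with (s', _) :: _ => s' = s | [] => True end) /\ wf m x L'
  end.

Definition wfst (m x : Z) (st : state) : Prop := wf m x (snd st).

Definition base : state := (0%Z, []).

Section Machine.
Context (m x : Z) (hm : (2 <= Z.abs m)%Z) (hx : (2 <= Z.abs x)%Z).

Lemma modulus_neq0 s : modulus m x s <> 0%Z.
Proof. destruct s; cbn; lia. Qed.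

Lemma quo_add s e k : quo m x s (e + modulus m x s * k)%Z = (quo m x s e + k)%Z.
Proof.
  unfold quo. rewrite <- Z.div_add by apply modulus_neq0. f_equal. ring.
Qed.

Lemma quo_small c : (2 * Z.abs c + 2 <= Z.abs x)%Z -> quo m x false c = 0%Z.
Proof.
  intros H. unfold quo. cbn.
  pose proof (Z.div_mod x 2 ltac:(lia)). pose proof (Z.mod_pos_bound x 2 ltac:(lia)).
  apply Z.div_small_iff; lia.
Qed.

Lemma quo_0 s : quo m x s 0 = 0%Z.
Proof. destruct s; [reflexivity|]. apply quo_small. cbn. lia. Qed.

Lemma quo_rmd s e : quo m x s (rmd m x s e) = 0%Z.
Proof.
  unfold rmd.
  replace (e - modulus m x s * quo m x s e)%Z with (e + modulus m x s * (- quo m x s e))%Z by ring.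
  rewrite quo_add. lia.
Qed.

Lemma rmd_add s e k : rmd m x s (e + modulus m x s * k)%Z = rmd m x s e.
Proof. unfold rmd. rewrite quo_add. ring. Qed.

Lemma rmd_quo0 s r : quo m x s r = 0%Z -> rmd m x s r = r.
Proof. unfold rmd. intros ->. ring. Qed.

Lemma act_wf l st : wfst m x st -> wfst m x (act m x l st).
Proof.
  destruct st as [e L], l as [g s]. unfold wfst. cbn [snd]. intros H.
  destruct g; [exact H|]. cbn [act snd].
  destruct L as [|[s' r'] L']; cbn [hop].
  - cbn. repeat split; auto using quo_rmd.
  - destruct (_ && _)%bool eqn:E; cbn [snd].
    + cbn in H. tauto.
    + cbn [wf]. split; [apply quo_rmd|]. split; [|exact H].
      intros Hr. rewrite Hr in E. cbn in E. now destruct s, s'.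
Qed.

(** If the first letter pushes a pair, the second pinches it off again. If the first pinches,
    well-formedness forbids a pinch below, so the second pushes the same pair back. *)
Lemma act_cancel l st : wfst m x st -> act m x l (act m x (letter_inv l) st) = st.
Proof.
  destruct st as [e L], l as [g s']. unfold wfst. cbn [snd]. intros H.
  destruct g; [destruct s'; cbn; f_equal; lia|].
  remember (negb s') as s eqn:Es.
  assert (Es' : s' = negb s) by (destruct s', s; easy). clear Es. subst s'.
  cbn [letter_inv fst snd act]. rewrite negb_involutive.
  assert (He : (modulus m x s * quo m x s e + rmd m x s e = e)%Z) by (unfold rmd; ring).
  assert (Hpush : (let h := hop (negb s) (rmd m x (negb s) (modulus m x (negb s) * quo m x s e))
       ((s, rmd m x s e) :: L) in
     ((modulus m x s * quo m x (negb s) (modulus m x (negb s) * quo m x s e) + fst h)%Z, snd h))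
     = (e, L)).
  { rewrite <- (Z.add_0_l (modulus m x (negb s) * _)), quo_add, rmd_add, quo_0.
    rewrite rmd_quo0 by apply quo_0. cbn [hop]. rewrite negb_involutive.
    rewrite Z.eqb_refl, eqb_reflx. cbn. f_equal. lia. }
  destruct L as [|[s' r'] L']; cbn [hop fst snd].
  - rewrite Z.add_0_r. exact Hpush.
  - destruct (_ && _)%bool eqn:E; cbn [fst snd].
    + apply andb_true_iff in E. destruct E as [E1 E2].
      apply Z.eqb_eq in E1. apply eqb_prop in E2. subst s'. clear Hpush.
      cbn in H. destruct H as (H1 & H2 & H3).
      rewrite (Z.add_comm (modulus m x (negb s) * _) r'), quo_add, rmd_add, H1.
      rewrite rmd_quo0 by exact H1.
      assert (Eh : hop (negb s) r' L' = (0%Z, (negb s, r') :: L')).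
      { destruct L' as [|[s'' r''] L'']; [reflexivity|]. cbn [hop].
        destruct (Z.eqb_spec r' 0); [|reflexivity].
        rewrite H2 by assumption. rewrite negb_involutive. now destruct s. }
      rewrite Eh. cbn. f_equal. lia.
    + rewrite Z.add_0_r. exact Hpush.
Qed.

(** The defining relation seen in the action: $a b^{mk} = b^{xk} a$ for [s] true, and $a^{-1} b^{xk}
    = b^{mk} a^{-1}$ for [s] false. *)
Lemma act_raise s k st :
  act m x (false, s) (raise (modulus m x s * k) st)
  = raise (modulus m x (negb s) * k) (act m x (false, s) st).
Proof.
  destruct st as [e L]. unfold raise. cbn [fst snd act].
  rewrite quo_add, rmd_add. f_equal. ring.
Qed.

Lemma actw_app u v st : actw m x (u ++ v) st = actw m x u (actw m x v st).
Proof. apply fold_right_app. Qed.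

Lemma actw_wf w st : wfst m x st -> wfst m x (actw m x w st).
Proof. apply fold_right_ok, act_wf. Qed.

Lemma actw_reduce w st : wfst m x st -> actw m x (reduce w) st = actw m x w st.
Proof. apply (fold_right_reduce _ (wfst m x)); [apply act_wf|apply act_cancel]. Qed.

Lemma actw_finv w st : wfst m x st -> actw m x w (actw m x (finv w) st) = st.
Proof. apply (fold_right_finv _ (wfst m x)); [apply act_wf|apply act_cancel]. Qed.

Lemma actw_bpow z st : actw m x (bpow z) st = raise z st.
Proof.
  destruct st as [e L]. unfold actw, bpow, raise. cbn [fst snd].
  assert (H : forall n s, fold_right (act m x) (e, L) (repeat (true, s) n)
                    = ((e + (if s then Z.of_nat n else - Z.of_nat n))%Z, L)).
  { intros n s. induction n as [|n IH].
    - cbn. f_equal. destruct s; lia.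
    - cbn [repeat fold_right]. rewrite IH. cbn [act].
      f_equal. destruct s; lia. }
  destruct (Z.leb_spec 0 z); rewrite H; f_equal; lia.
Qed.

(** The kernel of the action, which bounds the normal closure of the relator from above. All
    well-formed states are considered, not only [base], because a stabiliser need not be normal. *)
Lemma normal_trivial_action :
  IsNormalSub (fun w => reduced w = true /\ forall st, wfst m x st -> actw m x w st = st).
Proof.
  split; [now intros w [H _]|]. split; [now split|]. split; [|split].
  - intros u v [Hu Au] [Hv Av]. split; [apply reduced_reduce|]. intros st Hst.
    unfold fmul. rewrite actw_reduce, actw_app by assumption. now rewrite Av, Au.
  - intros u [Hu Au]. split; [now apply reduced_finv|]. intros st Hst.
    rewrite <- (Au (actw m x (finv u) st)) by now apply actw_wf.
    now apply actw_finv.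
  - intros g u Hg [Hu Au]. split; [apply reduced_reduce|]. intros st Hst.
    unfold fmul. rewrite actw_reduce, actw_app, actw_reduce, actw_app
      by auto using actw_wf.
    rewrite Au by now apply actw_wf. now apply actw_finv.
Qed.

Lemma BS_trivial_action w :
  BS m x w -> reduced w = true /\ forall st, wfst m x st -> actw m x w st = st.
Proof.
  intros H. apply (H _ normal_trivial_action). clear H.
  split; [apply reduced_reduce|]. intros st Hst. unfold bs_relator.
  rewrite actw_reduce by assumption.
  change (?l :: ?u) with ([l] ++ u). rewrite !actw_app, !actw_bpow.
  cbn [actw fold_right].
  (* In this form $a^{-1}$ carries $b^{-x}$ to $b^{-m}$, which cancels the $b^m$ of the relator. *)
  replace (- x)%Z with (modulus m x false * (-1))%Z by (cbn; lia).
  rewrite act_raise.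
  replace (raise m _) with (act m x (false, false) st).
  - apply (act_cancel (false, true)), Hst.
  - destruct (act m x (false, false) st) as [e L]. unfold raise. cbn. f_equal. lia.
Qed.

End Machine.

(** * Rewriting words to normal forms modulo the relation *)

Global Instance cong_equivalence N : Equivalence (cong N).
Proof.
  split; [intros u; apply cong_refl|intros u v; apply cong_sym|].
  intros u v w. apply cong_trans.
Qed.

Global Instance cong_app_proper N : Proper (cong N ==> cong N ==> cong N) (@app letter).
Proof. intros u u' H v v' H'. now apply cong_app. Qed.

Global Instance cong_cons_proper N l : Proper (cong N ==> cong N) (@cons letter l).
Proof. intros v v' H. now apply cong_cons. Qed.

Lemma cong_cancel N l v : cong N (l :: letter_inv l :: v) v.
Proof. apply (cong_app N [l; letter_inv l] [] v v); [apply (cong_finv N [l])|reflexivity]. Qed.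

Lemma bpow_succ N z : cong N (bpow (z + 1)) ((true, true) :: bpow z).
Proof.
  destruct (Z.leb_spec 0 z) as [H|H].
  - unfold bpow. rewrite !(proj2 (Z.leb_le 0 _)) by lia.
    now replace (Z.to_nat (z + 1)) with (S (Z.to_nat z)) by lia.
  - assert (E : bpow z = (true, false) :: bpow (z + 1)).
    { unfold bpow. rewrite (proj2 (Z.leb_gt 0 z)) by lia.
      replace (Z.to_nat (- z)) with (S (Z.to_nat (- z - 1))) by lia. cbn [repeat]. f_equal.
      destruct (Z.leb_spec 0 (z + 1)).
      - replace z with (-1)%Z by lia. reflexivity.
      - f_equal. lia. }
    rewrite E. symmetry. apply (cong_cancel N (true, true)).
Qed.

Lemma bpow_pred N z : cong N (bpow (z - 1)) ((true, false) :: bpow z).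
Proof.
  replace z with (z - 1 + 1)%Z at 2 by lia. rewrite bpow_succ.
  symmetry. apply (cong_cancel N (true, false)).
Qed.

Lemma bpow_add N y z : cong N (bpow (y + z)) (bpow y ++ bpow z).
Proof.
  revert y. apply Z.bi_induction.
  - intros ? ? ->. reflexivity.
  - reflexivity.
  - intros y. replace (Z.succ y + z)%Z with (y + z + 1)%Z by lia.
    rewrite <- Z.add_1_r, !bpow_succ. cbn. split; intros H.
    + now rewrite H.
    + rewrite <- (cong_cancel N (true, false) (bpow (y + z))).
      change (letter_inv (true, false)) with (true, true). rewrite H.
      apply (cong_cancel N (true, false)).
Qed.

Section Presentation.
Context (m x : Z) (N : word -> Prop) (HN : IsNormalSub N) (Hr : N (bs_relator m x)).

Lemma a_bpow_m : cong N ((false, true) :: bpow m) (bpow x ++ [(false, true)]).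
Proof.
  pose proof (cong_of_mem N _ HN Hr) as H.
  assert (H' : cong N (((false, true) :: bpow m ++ [(false, false)] ++ bpow (- x))
                 ++ bpow x ++ [(false, true)]) (bpow x ++ [(false, true)])).
  { now rewrite H. }
  rewrite <- H'. cbn. rewrite <- !app_assoc. cbn.
  rewrite (app_assoc (bpow (- x))), <- bpow_add, Z.add_opp_diag_l.
  change (bpow 0) with (@nil letter). cbn.
  change (false, true) with (letter_inv (false, false)) at 2.
  now rewrite (cong_cancel N (false, false) []), app_nil_r.
Qed.

Lemma a_bpow_modulus s k :
  cong N ((false, s) :: bpow (modulus m x s * k))
         (bpow (modulus m x (negb s) * k) ++ [(false, s)]).
Proof.
  assert (Ha : forall k, cong N ((false, true) :: bpow (m * k)) (bpow (x * k) ++ [(false, true)])).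
  { apply Z.bi_induction.
    - intros ? ? ->. reflexivity.
    - now rewrite !Z.mul_0_r.
    - intros j. replace (m * Z.succ j)%Z with (m + m * j)%Z by lia.
      replace (x * Z.succ j)%Z with (x + x * j)%Z by lia.
      rewrite !bpow_add. rewrite app_comm_cons, a_bpow_m, <- !app_assoc. cbn [app].
      split; intros H.
      + now rewrite H.
      + assert (Hl : forall v, cong N v (bpow (- x) ++ bpow x ++ v)).
        { intros v. rewrite app_assoc, <- bpow_add, Z.add_opp_diag_l. reflexivity. }
        rewrite (Hl (_ :: _)), H. symmetry. apply Hl. }
  destruct s; cbn; [apply Ha|].
  rewrite <- (app_nil_r (bpow (x * k))).
  rewrite <- (cong_cancel N (false, true) []) at 1. cbn.
  change (?l :: ?u :: ?v) with ([l] ++ [u] ++ v).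
  rewrite (app_assoc _ [(false, true)]), <- Ha. cbn.
  apply (cong_cancel N (false, false)).
Qed.

Fixpoint stack_word (L : list (bool * Z)) : word :=
  match L with
  | [] => []
  | (s, r) :: L' => (false, s) :: bpow r ++ stack_word L'
  end.

(** A transition of [act] uses only the relation in the form [a_bpow_modulus] and free cancellation,
    so it is sound modulo any normal subgroup containing the relator. *)
Lemma act_cong l st :
  cong N (l :: bpow (fst st) ++ stack_word (snd st))
         (bpow (fst (act m x l st)) ++ stack_word (snd (act m x l st))).
Proof.
  destruct st as [e L], l as [[] s]; cbn [fst snd act].
  - destruct s.
    + rewrite bpow_succ. reflexivity.
    + rewrite bpow_pred. reflexivity.
  - replace e with (modulus m x s * quo m x s e + rmd m x s e)%Z at 1 by (unfold rmd; ring).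
    rewrite !bpow_add, <- !app_assoc, app_comm_cons, a_bpow_modulus, <- !app_assoc.
    apply cong_app; [reflexivity|]. cbn [app].
    destruct L as [|[s' r'] L']; [reflexivity|]. cbn [hop].
    destruct (_ && _)%bool eqn:E; [|reflexivity].
    apply andb_true_iff in E. destruct E as [E1 E2].
    apply Z.eqb_eq in E1. apply eqb_prop in E2. subst s'. rewrite E1. cbn.
    apply (cong_cancel N (false, s)).
Qed.

Lemma actw_cong w :
  cong N w (bpow (fst (actw m x w base)) ++ stack_word (snd (actw m x w base))).
Proof.
  induction w as [|l w IH]; [reflexivity|].
  cbn [actw fold_right]. rewrite <- act_cong. now rewrite IH at 1.
Qed.

End Presentation.

(** Elements of the normal closure act trivially. Conversely, a word fixing [base] is congruent to
    the empty normal form modulo every normal subgroup containing the relator. *)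
Lemma BS_iff m x w : (2 <= Z.abs m)%Z -> (2 <= Z.abs x)%Z -> reduced w = true ->
  BS m x w <-> actw m x w base = base.
Proof.
  intros hm hx Hw. split; intros H.
  - apply BS_trivial_action in H; [|assumption..]. now apply H.
  - intros N HN Hr. pose proof (actw_cong m x N HN Hr w [] []) as Hc.
    rewrite H in Hc. cbn in Hc. rewrite app_nil_r, reduce_reduced in Hc by assumption.
    apply Hc, HN.
Qed.

Lemma BS_reduced m x w : BS m x w -> reduced w = true.
Proof.
  intros H. apply (H (fun w => reduced w = true)).
  - split; [easy|]. split; [easy|]. split; [|split].
    + intros. apply reduced_reduce.
    + intros. now apply reduced_finv.
    + intros. apply reduced_reduce.
  - apply reduced_reduce.
Qed.

Lemma BS_normal m x : IsNormalSub (BS m x).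
Proof.
  split; [apply BS_reduced|]. split; [|split; [|split]].
  - intros N HN _. apply HN.
  - intros u v Hu Hv N HN Hr. apply HN; [now apply Hu|now apply Hv].
  - intros u Hu N HN Hr. apply HN. now apply Hu.
  - intros g u Hg Hu N HN Hr. apply HN; [assumption|now apply Hu].
Qed.

(** * Dependence of relations on x *)

(* [b^(iter_exp m x i)] is the image of [b^m] under the (i+1)-fold iteration of
   [h |-> a h b^(-r) a^-1], with [r] the remainder modulo [m] of the exponent. *)
Fixpoint iter_exp (m x : Z) (i : nat) : Z :=
  match i with
  | O => x
  | S i => (x * (iter_exp m x i / m))%Z
  end.

Definition digit (m x : Z) (i : nat) : Z := (iter_exp m x i mod m)%Z.

Fixpoint lincomb (f : nat -> Z) (cs : list Z) (i : nat) : Z :=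
  match cs with
  | [] => 0
  | c :: cs => c * f i + lincomb f cs (S i)
  end%Z.

Lemma lincomb_ext f g cs i :
  (forall j, (i <= j < i + length cs)%nat -> f j = g j) -> lincomb f cs i = lincomb g cs i.
Proof.
  revert i. induction cs as [|c cs IH]; intros i H; [reflexivity|]. cbn in *.
  rewrite (H i), (IH (S i)) by (intros; try apply H; lia). reflexivity.
Qed.

Lemma lincomb_add_scal f g h (a b : Z) cs i :
  (forall j, f j = a * g j + b * h j)%Z ->
  lincomb f cs i = (a * lincomb g cs i + b * lincomb h cs i)%Z.
Proof.
  intros H. revert i. induction cs as [|c cs IH]; intros i; cbn; [ring|].
  rewrite IH, H. ring.
Qed.

Lemma lincomb_S f cs i : lincomb f cs (S i) = lincomb (fun j => f (S j)) cs i.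
Proof. revert i. induction cs as [|c cs IH]; intros i; cbn; [ring|]. now rewrite IH. Qed.

(** Each iteration divides by [m] and thereby loses one power of [m] in precision. *)
Lemma iter_exp_cong m x y k i : (i <= k)%nat -> m <> 0%Z ->
  (m ^ Z.of_nat k | x - y)%Z ->
  (m ^ Z.of_nat (k - i) | iter_exp m x i - iter_exp m y i)%Z.
Proof.
  intros Hi Hm H. induction i as [|i IH].
  - now rewrite Nat.sub_0_r.
  - destruct IH as [t Ht]; [lia|]. cbn [iter_exp].
    replace (k - i)%nat with (S (k - S i)) in Ht by lia.
    rewrite Nat2Z.inj_succ, Z.pow_succ_r in Ht by lia.
    set (p := (m ^ Z.of_nat (k - S i))%Z) in *.
    replace (iter_exp m x i) with (iter_exp m y i + (t * p) * m)%Z by lia.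
    rewrite Z.div_add by assumption.
    assert (Hp : (p | x - y)%Z).
    { apply (Z.divide_trans _ (m ^ Z.of_nat k)); [|assumption].
      exists (m ^ Z.of_nat (S i))%Z. unfold p. rewrite <- Z.pow_add_r by lia. f_equal. lia. }
    destruct Hp as [s Hs].
    exists (s * (iter_exp m y i / m) + x * t)%Z.
    replace x with (y + s * p)%Z by lia. ring.
Qed.

Lemma mod_eq_of_divide m a b : m <> 0%Z -> (m | a - b)%Z -> (a mod m = b mod m)%Z.
Proof.
  intros Hm [t Ht]. replace a with (b + t * m)%Z by lia. now apply Z.mod_add.
Qed.

Lemma divide_of_mod_eq m a b : m <> 0%Z -> (a mod m = b mod m)%Z -> (m | a - b)%Z.
Proof.
  intros Hm H. exists (a / m - b / m)%Z.
  rewrite (Z.div_mod a m), (Z.div_mod b m) at 1 by assumption. rewrite H. ring.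
Qed.

Lemma digit_cong m x y k i : (i < k)%nat -> m <> 0%Z ->
  (m ^ Z.of_nat k | x - y)%Z -> digit m x i = digit m y i.
Proof.
  intros Hi Hm H. apply mod_eq_of_divide; [assumption|].
  apply (Z.divide_trans _ (m ^ Z.of_nat (k - i))); [|now apply iter_exp_cong; [lia|..]].
  replace (k - i)%nat with (S (k - i - 1)) by lia.
  rewrite Nat2Z.inj_succ, Z.pow_succ_r by lia. apply Z.divide_factor_l.
Qed.

(** Keeps the leading coefficient $d x^i$ of the difference modulo [m], so that at $i = j$ the digit
    of a unit [x] detects $d$ modulo [m]. *)
Lemma iter_exp_sub m x y j d i : (i <= j)%nat -> m <> 0%Z ->
  (x - y = d * m ^ Z.of_nat j)%Z ->
  exists t, (iter_exp m x i - iter_exp m y i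
             = (d * x ^ Z.of_nat i + t * m) * m ^ Z.of_nat (j - i))%Z.
Proof.
  intros Hi Hm H. induction i as [|i IH].
  - exists 0%Z. rewrite Nat.sub_0_r. cbn [iter_exp]. rewrite H. cbn. ring.
  - destruct IH as [t Ht]; [lia|]. cbn [iter_exp].
    replace (j - i)%nat with (S (j - S i)) in Ht by lia.
    replace j with (i + S (j - S i))%nat in H by lia.
    rewrite Nat2Z.inj_add, Z.pow_add_r in H by lia.
    rewrite !(Nat2Z.inj_succ (j - S i)), !Z.pow_succ_r in * by lia.
    rewrite Nat2Z.inj_succ, Z.pow_succ_r by lia.
    set (p := (m ^ Z.of_nat (j - S i))%Z) in *.
    replace (iter_exp m x i) with
      (iter_exp m y i + ((d * x ^ Z.of_nat i + t * m) * p) * m)%Z by lia.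
    rewrite Z.div_add by assumption.
    (* Here $x - y = d m^{i+1} p$, so its own contribution goes entirely into the multiple of
       [m]. *)
    exists (d * m ^ Z.of_nat i * (iter_exp m y i / m) + x * t)%Z.
    replace (x * (iter_exp m y i / m + (d * x ^ Z.of_nat i + t * m) * p)
             - y * (iter_exp m y i / m))%Z with
      ((x - y) * (iter_exp m y i / m) + x * ((d * x ^ Z.of_nat i + t * m) * p))%Z by ring.
    rewrite H. ring.
Qed.

(** Induction on [k]: from $x - y = d m^j$ and equal digits at [j], [iter_exp_sub] gives $m \mid d
    x^j$, and invertibility of [x] modulo [m] gives $m \mid d$. *)
Lemma digits_inj m x y k u : (2 <= Z.abs m)%Z -> (m | x * u - 1)%Z ->
  (forall i, (i < k)%nat -> digit m x i = digit m y i) -> (m ^ Z.of_nat k | x - y)%Z.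
Proof.
  intros Hm Hu. induction k as [|j IH]; intros H; [apply Z.divide_1_l|].
  destruct IH as [d Hd]; [intros; apply H; lia|].
  destruct (iter_exp_sub m x y j d j) as [t Ht]; [lia|lia|assumption|].
  rewrite Nat.sub_diag, Z.mul_1_r in Ht.
  pose proof (divide_of_mod_eq m _ _ ltac:(lia) (H j ltac:(lia))) as Hdiv.
  rewrite Ht in Hdiv.
  assert (Hd' : (m | d * x ^ Z.of_nat j)%Z).
  { apply (Z.divide_add_cancel_r m (t * m)); [apply Z.divide_factor_r|].
    now rewrite Z.add_comm. }
  assert (Hg : forall i e, (m | e * x ^ Z.of_nat i)%Z -> (m | e)%Z).
  { induction i as [|i IHi]; intros e He.
    - now rewrite Z.mul_1_r in He.
    - apply IHi. rewrite Nat2Z.inj_succ, Z.pow_succ_r in He by lia.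
      destruct He as [v Hv], Hu as [w Hw].
      exists (v * u - e * x ^ Z.of_nat i * w)%Z.
      replace ((v * u - e * x ^ Z.of_nat i * w) * m)%Z
        with (v * m * u - e * x ^ Z.of_nat i * (w * m))%Z by ring.
      rewrite <- Hv, <- Hw. ring. }
  apply Hg in Hd'. destruct Hd' as [v ->].
  exists v. rewrite Hd, Nat2Z.inj_succ, Z.pow_succ_r by lia. ring.
Qed.

(* The formal counterpart of [state]: the exponent [c0 + sum_j cs_j iter_exp j] is kept
   as a formal sum, which makes sense for all large [x] with the same digits. *)
Definition fstate := (Z * list Z * list (bool * Z))%type.

(** Here [rho] stands for the digits. The letter $a$ sends $\lfloor E_j/m\rfloor$ to $E_{j+1}$,
    which shifts the coefficients up, and the quotient of the digit part becomes the coefficient of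
    $E_0$. The letter $a^{-1}$ shifts down, replacing $E_{j+1}$ by $E_j - \rho_j$ and $E_0$ by
    $m$. *)
Definition fact (m : Z) (rho : nat -> Z) (l : letter) (st : fstate) : fstate :=
  let '(c, cs, L) := st in
  let (g, s) := l in
  if g then ((if s then c + 1 else c - 1)%Z, cs, L)
  else if s then
    let v := (c + lincomb rho cs 0)%Z in
    let h := hop true (v mod m) L in (fst h, (v / m)%Z :: cs, snd h)
  else
    let h := hop false c L in
    match cs with
    | [] => (fst h, [], snd h)
    | q :: cs => ((m * q - lincomb rho cs 0 + fst h)%Z, cs, snd h)
    end.

Definition factw m rho (w : word) : fstate := fold_right (fact m rho) (0%Z, [], []) w.

Definition feval (m x : Z) (st : fstate) : state :=
  let '(c, cs, L) := st in ((c + lincomb (iter_exp m x) cs 0)%Z, L).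

Definition count_a (s : bool) (w : word) : nat :=
  length (filter (fun l => (negb (fst l) && Bool.eqb (snd l) s)%bool) w).

Definition fdeg (st : fstate) : nat := length (snd (fst st)).

(** Only the letter $a$ lengthens the formal sum; this bounds how many digits a word can consult. *)
Lemma fdeg_factw m rho w : (fdeg (factw m rho w) <= count_a true w)%nat.
Proof.
  induction w as [|[g s] w IH]; [reflexivity|].
  cbn [factw fold_right]. change (fold_right _ _ w) with (factw m rho w).
  destruct (factw m rho w) as [[c cs] L]. unfold count_a, fdeg in *. cbn in IH.
  destruct g, s; cbn; try lia.
  destruct cs; cbn in *; lia.
Qed.

Lemma lincomb_iter_exp m x rho cs : m <> 0%Z ->
  (forall i, (i < length cs)%nat -> digit m x i = rho i) ->
  (lincomb (iter_exp m x) cs 0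
   = lincomb rho cs 0 + m * lincomb (fun j => iter_exp m x j / m) cs 0)%Z.
Proof.
  intros Hm H. rewrite <- (lincomb_ext (digit m x) rho) by (intros; apply H; lia).
  rewrite (lincomb_add_scal (iter_exp m x) (digit m x) (fun j => iter_exp m x j / m)%Z 1 m).
  - ring.
  - intros j. rewrite (Z.div_mod (iter_exp m x j) m) at 1 by assumption.
    unfold digit. ring.
Qed.

Lemma lincomb_iter_exp_S m x cs i :
  lincomb (iter_exp m x) cs (S i) = (x * lincomb (fun j => iter_exp m x j / m)%Z cs i)%Z.
Proof.
  rewrite lincomb_S.
  rewrite (lincomb_add_scal (fun j => iter_exp m x (S j)) (fun j => iter_exp m x j / m)%Z
             (fun j => 0%Z) x 0) by (intros; cbn; ring). ring.
Qed.

(** All iterates are multiples of [x], so for $a^{-1}$ a small constant term is exactly the centred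
    remainder. For $a$ the remainder is read off the digits. *)
Lemma act_feval m x rho l st : (2 <= Z.abs m)%Z ->
  (2 * Z.abs (fst (fst st)) + 2 <= Z.abs x)%Z ->
  (forall i, (i < fdeg st)%nat -> digit m x i = rho i) ->
  act m x l (feval m x st) = feval m x (fact m rho l st).
Proof.
  intros hm Hc Hd. destruct st as [[c cs] L], l as [g s]. cbn [fst snd] in Hc.
  destruct g; [destruct s; cbn; f_equal; lia|].
  unfold fdeg in Hd. cbn in Hd.
  destruct s.
  - cbn [feval act fact]. rewrite (lincomb_iter_exp m x rho) by (assumption || lia).
    rewrite Z.add_assoc, rmd_add, quo_add by lia.
    set (v := (c + lincomb rho cs 0)%Z).
    assert (Eq : quo m x true v = (v / m)%Z) by (unfold quo; cbn; f_equal; lia).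
    assert (Er : rmd m x true v = (v mod m)%Z).
    { unfold rmd. rewrite Eq. cbn. rewrite (Z.div_mod v m) at 1 by lia. lia. }
    rewrite Er, Eq. destruct (hop _ _ _) as [d L']. cbn [fst snd feval]. f_equal.
    cbn [lincomb]. rewrite lincomb_iter_exp_S. cbn. ring.
  - destruct cs as [|q cs].
    + cbn [feval act fact lincomb]. rewrite Z.add_0_r.
      assert (Eq : quo m x false c = 0%Z) by (apply quo_small; lia).
      rewrite rmd_quo0, Eq by assumption. cbn.
      destruct (hop _ _ _) as [d L']. cbn. f_equal. lia.
    + cbn [feval act fact lincomb].
      assert (Eq : quo m x false c = 0%Z) by (apply quo_small; lia).
      rewrite lincomb_iter_exp_S. cbn [iter_exp].
      replace (c + _)%Z with
        (c + modulus m x false * (q + lincomb (fun j => iter_exp m x j / m) cs 0))%Z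
        by (cbn; ring).
      rewrite rmd_add, quo_add by lia. rewrite rmd_quo0, Eq by assumption.
      destruct (hop _ _ _) as [d L']. cbn [fst snd feval]. f_equal.
      rewrite (lincomb_iter_exp m x rho) by (intros; try apply Hd; cbn; lia). cbn. ring.
Qed.

Lemma actw_feval m rho k w : (2 <= Z.abs m)%Z -> (count_a true w <= k)%nat ->
  exists M, forall x, (M <= Z.abs x)%Z -> (forall i, (i < k)%nat -> digit m x i = rho i) ->
    actw m x w base = feval m x (factw m rho w).
Proof.
  intros hm. induction w as [|l w IH]; intros Hk.
  - exists 0%Z. reflexivity.
  - assert (Hk' : (count_a true w <= k)%nat).
    { unfold count_a in *. cbn in Hk. destruct (negb _ && _)%bool; cbn in Hk; lia. }
    destruct (IH Hk') as [M HM].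
    (* The constant terms met along the word depend on [rho] but not on [x], so finitely many
       thresholds suffice. *)
    exists (Z.max M (2 * Z.abs (fst (fst (factw m rho w))) + 2)). intros x Hx Hd.
    cbn [actw fold_right]. change (fold_right _ _ w) with (actw m x w base).
    rewrite HM by (assumption || lia).
    apply (act_feval m x rho l (factw m rho w)); [assumption|lia|].
    intros i Hi. apply Hd. pose proof (fdeg_factw m rho w). lia.
Qed.

(** The sum is $c + xT$, which for $|x| > |c|$ vanishes only if $c = 0$ and $T = 0$. Moreover $mT$
    is again a formal sum, with one coefficient fewer, so the condition unwinds to one without
    [x]. *)
Lemma lincomb_zero_stable m rho k cs c : (2 <= Z.abs m)%Z -> (length cs <= k)%nat ->
  exists (b : Prop) M, forall x, (M <= Z.abs x)%Z ->
    (forall i, (i < k)%nat -> digit m x i = rho i) ->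
    ((c + lincomb (iter_exp m x) cs 0 = 0)%Z <-> b).
Proof.
  intros hm. revert c. induction cs as [|q cs IH]; intros c Hk.
  - exists (c = 0%Z), 0%Z. intros. cbn. lia.
  - cbn in Hk.
    destruct (IH (m * q - lincomb rho cs 0)%Z) as (b & M & HM); [lia|].
    exists (c = 0%Z /\ b), (Z.max M (Z.abs c + 1)). intros x Hx Hd.
    rewrite <- (HM x) by (assumption || lia). clear HM IH.
    cbn [lincomb]. rewrite lincomb_iter_exp_S. cbn [iter_exp].
    rewrite (lincomb_iter_exp m x rho) by (intros; try apply Hd; lia).
    set (t := lincomb (fun j => iter_exp m x j / m)%Z cs 0).
    transitivity (c = 0%Z /\ (q + t = 0)%Z); [|nia].
    split; [|nia]. intros H. assert (Hq : (c = x * - (q + t))%Z) by lia.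
    destruct (Z.eq_dec (q + t) 0) as [E|E]; [rewrite E in Hq; lia|].
    exfalso. assert (Z.abs c = Z.abs x * Z.abs (q + t))%Z
      by (rewrite Hq, Z.abs_mul, Z.abs_opp; reflexivity).
    nia.
Qed.

Lemma BS_stable_count m k c w : (2 <= Z.abs m)%Z -> reduced w = true ->
  (count_a true w <= k)%nat ->
  exists (b : Prop) M, forall x, (M <= Z.abs x)%Z -> (m ^ Z.of_nat k | x - c)%Z ->
    (BS m x w <-> b).
Proof.
  intros hm Hw Hk.
  destruct (actw_feval m (digit m c) k w hm Hk) as [M1 HM1].
  pose proof (fdeg_factw m (digit m c) w) as Hdeg.
  destruct (factw m (digit m c) w) as [[c0 cs] L]. unfold fdeg in Hdeg. cbn in Hdeg.
  destruct (lincomb_zero_stable m (digit m c) k cs c0 hm) as (b & M2 & HM2); [lia|].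
  exists (b /\ L = []), (Z.max 2 (Z.max M1 M2)). intros x Hx Hdiv.
  assert (Hd : forall i, (i < k)%nat -> digit m x i = digit m c i).
  { intros i Hi. apply (digit_cong m x c k); [assumption|lia|assumption]. }
  rewrite BS_iff, HM1, <- (HM2 x) by (assumption || lia).
  cbn. unfold base. split; [now intros [= -> ->]|]. now intros [-> ->].
Qed.

(** * Exponent sum in $a$, and relations of bounded length *)

Definition expsum (w : word) : Z := (Z.of_nat (count_a true w) - Z.of_nat (count_a false w))%Z.

(** Presents the exponent sum as a letterwise action on the integers, so that [fold_right_reduce]
    applies. *)
Lemma fold_right_expsum w z :
  fold_right (fun (l : letter) z => if fst l then z else if snd l then z + 1 else z - 1)%Z z w
  = (z + expsum w)%Z.
Proof.
  induction w as [|[g s] w IH]; unfold expsum, count_a in *; cbn [fold_right filter fst snd].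
  - cbn. lia.
  - rewrite IH. destruct g, s; cbn [negb andb Bool.eqb length]; lia.
Qed.

Lemma expsum_reduce w : expsum (reduce w) = expsum w.
Proof.
  pose proof (fold_right_reduce
    (fun (l : letter) z => if fst l then z else if snd l then z + 1 else z - 1)%Z (fun _ => True)
    ltac:(auto)) as H.
  specialize (H ltac:(intros [[] []] z _; cbn; lia) w 0%Z I).
  rewrite !fold_right_expsum in H. lia.
Qed.

Lemma expsum_app u v : expsum (u ++ v) = (expsum u + expsum v)%Z.
Proof.
  unfold expsum, count_a. rewrite !filter_app, !length_app, !Nat2Z.inj_add.
  unfold word, letter. lia.
Qed.

Lemma expsum_finv u : expsum (finv u) = (- expsum u)%Z.
Proof.
  pose proof (expsum_reduce (u ++ finv u ++ [])) as H.
  rewrite reduce_finv, !expsum_app in H. change (expsum []) with 0%Z in *.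
  change (expsum (reduce [])) with 0%Z in H. lia.
Qed.

Lemma expsum_bpow z : expsum (bpow z) = 0%Z.
Proof.
  unfold bpow. destruct (0 <=? z)%Z; [generalize (Z.to_nat z)|generalize (Z.to_nat (- z))];
  now induction n.
Qed.

Lemma BS_expsum m x w : BS m x w -> expsum w = 0%Z.
Proof.
  intros H. apply (H (fun w => reduced w = true /\ expsum w = 0%Z)).
  - split; [now intros u []|]. split; [easy|]. split; [|split].
    + intros u v [? Hu] [? Hv]. split; [apply reduced_reduce|].
      unfold fmul. rewrite expsum_reduce, expsum_app. lia.
    + intros u [? Hu]. split; [now apply reduced_finv|]. rewrite expsum_finv. lia.
    + intros g u ? [? Hu]. split; [apply reduced_reduce|].
      unfold fmul. rewrite expsum_reduce, expsum_app, expsum_reduce, expsum_app, expsum_finv. lia.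
  - split; [apply reduced_reduce|]. unfold bs_relator. rewrite expsum_reduce.
    change (?l :: ?u) with ([l] ++ u). rewrite !expsum_app, !expsum_bpow. reflexivity.
Qed.

Lemma count_a_length w : (count_a true w + count_a false w <= length w)%nat.
Proof. induction w as [|[[] []] w IH]; unfold count_a in *; cbn in *; lia. Qed.

(* A relation has exponent sum 0 in [a], so at most half of its letters are [a]. *)
Lemma BS_stable m k c w : (2 <= Z.abs m)%Z -> reduced w = true -> (length w <= 2 * k + 1)%nat ->
  exists (b : Prop) M, forall x, (M <= Z.abs x)%Z -> (m ^ Z.of_nat k | x - c)%Z ->
    (BS m x w <-> b).
Proof.
  intros hm Hw Hl. destruct (Z.eq_dec (expsum w) 0) as [E|E].
  - apply BS_stable_count; [assumption|assumption|].
    pose proof (count_a_length w). unfold expsum in E. lia.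
  - exists False, 0%Z. intros x _ _. split; [|easy]. intros H. now apply BS_expsum in H.
Qed.

(** * Words separating residue classes *)

Fixpoint iter_word (m x : Z) (i : nat) : word :=
  match i with
  | O => (false, true) :: bpow m ++ [(false, false)]
  | S i => (false, true) :: iter_word m x i ++ bpow (- digit m x i) ++ [(false, false)]
  end.

Definition sep_word (m x : Z) (i : nat) : word :=
  iter_word m x i ++ [(true, true)] ++ finv (iter_word m x i) ++ [(true, false)].

Lemma length_bpow z : length (bpow z) = Z.abs_nat z.
Proof. unfold bpow. destruct (Z.leb_spec 0 z); rewrite repeat_length; lia. Qed.

Lemma length_iter_word m x i : (2 <= Z.abs m)%Z ->
  (length (iter_word m x i) <= (Z.abs_nat m + 1) * (i + 1) + 1)%nat.
Proof.
  intros hm. induction i as [|i IH]; cbn [iter_word length];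
    rewrite !length_app, length_bpow; cbn [length].
  - lia.
  (* With the two letters $a^{\pm1}$, each level thus adds at most $|m|+1$ letters; this is the
     source of the factor $|m|+1$ in the lower bound. *)
  - assert (Z.abs_nat (- digit m x i) <= Z.abs_nat m - 1)%nat; [|lia].
    unfold digit. destruct (Z.lt_ge_cases 0 m).
    + pose proof (Z.mod_pos_bound (iter_exp m x i) m ltac:(lia)). lia.
    + pose proof (Z.mod_neg_bound (iter_exp m x i) m ltac:(lia)). lia.
Qed.

Lemma length_sep_word m x i : (2 <= Z.abs m)%Z ->
  (length (sep_word m x i) <= 2 * (Z.abs_nat m + 1) * (i + 1) + 4)%nat.
Proof.
  intros hm. pose proof (length_iter_word m x i hm). unfold sep_word, finv.
  rewrite !length_app, length_rev, length_map. cbn [length]. lia.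
Qed.

Lemma raise_raise y z st : raise y (raise z st) = raise (y + z) st.
Proof. unfold raise. cbn. f_equal. lia. Qed.

Lemma raise_opp z st : raise (- z) (raise z st) = st.
Proof. destruct st. unfold raise. cbn. f_equal. lia. Qed.

Lemma hop_neq0 s r L : r <> 0%Z -> hop s r L = (0%Z, (s, r) :: L).
Proof.
  intros H. destruct L as [|[s' r'] L]; [reflexivity|]. cbn.
  now rewrite (proj2 (Z.eqb_neq r 0) H).
Qed.

Lemma actw_conj_a m y n st : (2 <= Z.abs m)%Z -> (2 <= Z.abs y)%Z -> wfst m y st ->
  act m y (false, true) (raise (m * n) (act m y (false, false) st)) = raise (y * n) st.
Proof.
  intros hm hy Hst. rewrite (act_raise m y hm hy true n). cbn [negb modulus]. f_equal.
  now apply (act_cancel m y hm hy (false, true)).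
Qed.

(** Subtracting the correct digit leaves a multiple of [m], which conjugation by $a$ turns into the
    corresponding multiple of [y]. *)
Lemma actw_iter_word m x y j st : (2 <= Z.abs m)%Z -> (2 <= Z.abs y)%Z -> wfst m y st ->
  (forall i, (i < j)%nat -> digit m x i = digit m y i) ->
  actw m y (iter_word m x j) st = raise (iter_exp m y j) st.
Proof.
  intros hm hy. revert st. induction j as [|j IH]; intros st Hst Hd; cbn [iter_word].
  - change (?l :: ?u) with ([l] ++ u). rewrite !actw_app, actw_bpow.
    cbn [actw fold_right]. rewrite <- (Z.mul_1_r m) at 2.
    rewrite actw_conj_a by assumption. cbn. f_equal. lia.
  - change (?l :: ?u) with ([l] ++ u). rewrite !actw_app, actw_bpow.
    rewrite IH by (intros; try apply Hd; lia || now apply (act_wf m y hm hy)).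
    cbn [actw fold_right]. rewrite raise_raise, Hd by lia. cbn [iter_exp].
    replace (iter_exp m y j + - digit m y j)%Z with (m * (iter_exp m y j / m))%Z.
    + now apply actw_conj_a.
    + unfold digit. pose proof (Z.div_mod (iter_exp m y j) m ltac:(lia)). lia.
Qed.

Lemma actw_sep_word m x j st : (2 <= Z.abs m)%Z -> (2 <= Z.abs x)%Z -> wfst m x st ->
  actw m x (sep_word m x j) st = st.
Proof.
  intros hm hx Hst. unfold sep_word. rewrite !actw_app.
  set (st' := actw m x [(true, false)] st).
  assert (Hst' : wfst m x st') by now apply actw_wf.
  assert (E : raise (iter_exp m x j) (actw m x (finv (iter_word m x j)) st') = st').
  { rewrite <- (actw_iter_word m x x) by auto using actw_wf. now apply actw_finv. }
  rewrite actw_iter_word by auto using actw_wf.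
  set (st'' := actw m x (finv _) st') in *.
  change [(true, true)] with (bpow 1). rewrite actw_bpow, raise_raise.
  rewrite Z.add_comm, <- raise_raise, E. unfold st'.
  change [(true, false)] with (bpow (-1)). rewrite actw_bpow. apply (raise_opp (-1)).
Qed.

(* The exponent that [finv t] conjugates is not a multiple of [m], so no pinch occurs
   and Britton's lemma applies. *)
Lemma actw_sep_word_neq m x y j : (2 <= Z.abs m)%Z -> (4 <= Z.abs y)%Z ->
  (forall i, (i < j)%nat -> digit m x i = digit m y i) -> digit m x j <> digit m y j ->
  actw m y (sep_word m x (S j)) base <> base.
Proof.
  intros hm hy Hd Hj. assert (hy' : (2 <= Z.abs y)%Z) by lia.
  set (n := (iter_exp m y j - digit m x j)%Z).
  (* The digits at [j] differ, so $n$ is not divisible by [m], and every later $a$ must push. *)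
  assert (Hn : forall s z, s = n \/ s = (- n)%Z -> rmd m y true (m * z + s) <> 0%Z).
  { intros s z Hs H. rewrite Z.add_comm, (rmd_add m y hm hy' true) in H.
    unfold rmd in H. cbn in H. set (q := quo m y true s) in H.
    apply Hj. pose proof (Z.div_mod (iter_exp m x j) m ltac:(lia)) as Hx.
    symmetry. unfold digit at 1.
    assert (Hdiv : (m | iter_exp m y j - digit m x j)%Z).
    { fold n. destruct Hs as [->| ->]; [exists q|exists (- q)%Z]; lia. }
    apply mod_eq_of_divide in Hdiv; [|lia]. rewrite Hdiv.
    unfold digit. now rewrite Z.mod_mod by lia. }
  assert (Ht : forall st, wfst m y st -> actw m y (iter_word m x (S j)) st
                = act m y (false, true) (raise n (act m y (false, false) st))).
  { intros st Hst. cbn [iter_word]. change (?l :: ?u) with ([l] ++ u).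
    rewrite !actw_app, actw_bpow.
    rewrite actw_iter_word by (assumption || now apply (act_wf m y hm hy')).
    rewrite raise_raise. reflexivity. }
  (* The word acts as $a b^n a^{-1}$, hence its inverse as $a b^{-n} a^{-1}$. *)
  assert (Hti : forall st, wfst m y st -> actw m y (finv (iter_word m x (S j))) st
                = act m y (false, true) (raise (- n) (act m y (false, false) st))).
  { intros st Hst. set (s := act m y (false, true) _).
    assert (Hs : wfst m y s).
    { apply (act_wf m y hm hy'). apply (act_wf m y hm hy' (false, false)) in Hst. exact Hst. }
    assert (E : actw m y (iter_word m x (S j)) s = st).
    { rewrite Ht by assumption. unfold s.
      rewrite (act_cancel m y hm hy' (false, false)) by
        (apply (act_wf m y hm hy' (false, false)) in Hst; exact Hst).
      rewrite raise_raise, Z.add_opp_diag_r.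
      replace (raise 0 _) with (act m y (false, false) st).
      - now apply (act_cancel m y hm hy' (false, true)).
      - destruct (act m y (false, false) st). unfold raise. cbn. f_equal. lia. }
    rewrite <- E at 1. rewrite <- (finv_involutive (iter_word m x (S j))) at 2.
    now apply actw_finv. }
  unfold sep_word. rewrite !actw_app.
  rewrite Hti by apply I. rewrite Ht by (do 4 apply (act_wf m y hm hy'); exact I).
  change (actw m y [(true, false)] base) with ((-1)%Z, @nil (bool * Z)).
  set (st1 := act m y (false, false) (-1, [])%Z).
  (* The bound $4 \le |y|$ makes $\pm1$ their own centred remainders, here and in [E3], so they
     enter the stack unchanged. *)
  assert (E1 : st1 = (m * 0, [(false, (-1))])%Z).
  { unfold st1. cbn [act]. rewrite rmd_quo0; rewrite ?(quo_small m y) by lia;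
      cbn -[Z.mul]; f_equal; lia || reflexivity. }
  rewrite E1. unfold raise at 2. cbn [fst snd].
  assert (E2 : exists r q, act m y (false, true) (m * 0 + - n, [(false, -1)])%Z
                = (y * q, [(true, r); (false, -1)])%Z).
  { cbn [act]. rewrite hop_neq0 by (apply Hn; auto).
    eexists _, _. cbn [fst snd negb modulus]. now rewrite Z.add_0_r. }
  destruct E2 as (r & q & ->).
  change (actw m y [(true, true)] ?st) with (act m y (true, true) st). cbn [act].
  assert (E3 : exists q', act m y (false, false) (y * q + 1, [(true, r); (false, -1)])%Z
                = (m * q', [(false, 1); (true, r); (false, -1)])%Z).
  { cbn [act]. replace (y * q + 1)%Z with (1 + modulus m y false * q)%Z by (cbn [modulus]; lia).
    rewrite rmd_add by assumption.
    rewrite (rmd_quo0 m y false 1) by (apply quo_small; lia).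
    rewrite hop_neq0 by lia. eexists. cbn [fst snd negb modulus]. now rewrite Z.add_0_r. }
  cbn [act] in E3. destruct E3 as (q' & ->). unfold raise. cbn [fst snd act].
  rewrite hop_neq0 by (apply Hn; auto). cbn. intros [=].
Qed.

Lemma first_failure (P : nat -> Prop) k :
  (forall i, (i < k)%nat -> P i) \/
  exists j, (j < k)%nat /\ ~ P j /\ forall i, (i < j)%nat -> P i.
Proof.
  induction k as [|k IH].
  - left. lia.
  - destruct IH as [H|(j & Hj & H)]; [|right; exists j; split; [lia|assumption]].
    destruct (classic (P k)) as [HP|HP].
    + left. intros i Hi. destruct (Nat.eq_dec i k) as [->|]; [assumption|]. apply H. lia.
    + right. exists k. auto.
Qed.

(** By [digits_inj] some digit below [k] differs. At the first such index $j$, the separating word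
    of level $j+1$ uses exactly the digits $0,\dots,j$ of [x]. *)
Lemma BS_separate m x y u k : (2 <= Z.abs m)%Z -> (4 <= Z.abs x)%Z -> (4 <= Z.abs y)%Z ->
  (m | x * u - 1)%Z -> ~ (m ^ Z.of_nat k | x - y)%Z ->
  exists w, reduced w = true /\ (length w <= 2 * (Z.abs_nat m + 1) * (k + 1) + 4)%nat /\
    BS m x w /\ ~ BS m y w.
Proof.
  intros hm hx hy Hu Hk.
  destruct (first_failure (fun i => digit m x i = digit m y i) k) as [H|(j & Hj & Hne & Heq)].
  - now destruct Hk; apply (digits_inj m x y k u).
  - exists (reduce (sep_word m x (S j))). split; [apply reduced_reduce|]. split; [|split].
    + pose proof (length_reduce (sep_word m x (S j))).
      pose proof (length_sep_word m x (S j) hm).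
      assert ((Z.abs_nat m + 1) * (S j + 1) <= (Z.abs_nat m + 1) * (k + 1))%nat
        by (apply Nat.mul_le_mono_l; lia). lia.
    + apply BS_iff; [assumption|lia|apply reduced_reduce|].
      rewrite actw_reduce by (lia || exact I). apply actw_sep_word; [assumption|lia|exact I].
    + rewrite BS_iff by (lia || apply reduced_reduce).
      rewrite actw_reduce by (lia || exact I). now apply actw_sep_word_neq.
Qed.

(** * Distances between limits *)

Lemma mdist_cases N1 N2 :
  ((forall w, ~ symdiff N1 N2 w) /\ mdist N1 N2 = 0) \/
  (exists w, symdiff N1 N2 w /\ mdist N1 N2 = exp (- INR (wlen w)) /\
     forall w', symdiff N1 N2 w' -> (wlen w <= wlen w')%nat).
Proof.
  unfold mdist. apply epsilon_spec.
  destruct (classic (exists w, symdiff N1 N2 w)) as [[w Hw]|H].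
  - destruct (dec_inh_nat_subset_has_unique_least_element
      (fun n => exists w, symdiff N1 N2 w /\ wlen w = n)) as (n & ((v & Hv & <-) & Hmin) & _).
    + intros n. apply classic.
    + now exists (wlen w), w.
    + exists (exp (- INR (wlen v))). right. exists v. repeat split; try apply Hv.
      intros w' Hw'. apply Hmin. now exists w'.
  - exists 0. left. split; [|reflexivity]. intros w Hw. apply H. now exists w.
Qed.

Lemma exp_INR_le a b : (a <= b)%nat -> exp (- INR b) <= exp (- INR a).
Proof.
  intros [H|H]%Nat.lt_eq_cases.
  - left. apply exp_increasing. apply lt_INR in H. lra.
  - subst. lra.
Qed.

Lemma mdist_le N1 N2 n :
  (forall w, symdiff N1 N2 w -> (n <= length w)%nat) -> mdist N1 N2 <= exp (- INR n).
Proof.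
  intros H. destruct (mdist_cases N1 N2) as [[_ ->]|(w & Hw & -> & _)].
  - left. apply exp_pos.
  - now apply exp_INR_le, H.
Qed.

Lemma mdist_ge N1 N2 w : symdiff N1 N2 w -> exp (- INR (length w)) <= mdist N1 N2.
Proof.
  intros H. destruct (mdist_cases N1 N2) as [[Hn _]|(v & _ & -> & Hmin)].
  - now destruct (Hn w).
  - now apply exp_INR_le, Hmin.
Qed.

Lemma mdist_bounds N1 N2 : 0 <= mdist N1 N2 <= 1.
Proof.
  split.
  - destruct (mdist_cases N1 N2) as [[_ ->]|(w & _ & -> & _)]; [lra|]. left. apply exp_pos.
  - rewrite <- exp_0, <- Ropp_0. apply (mdist_le _ _ 0). intros; lia.
Qed.

Lemma mdist_lt_agree N1 N2 L w : mdist N1 N2 < exp (- INR L) ->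
  reduced w = true -> (length w <= L)%nat -> (N1 w <-> N2 w).
Proof.
  intros Hd Hw Hl. apply NNPP. intros H.
  pose proof (mdist_ge N1 N2 w (conj Hw H)). pose proof (exp_INR_le _ _ Hl). lra.
Qed.

Lemma madic_mod m x k l : (2 <= Z.abs m)%Z -> madic m x -> (k <= l)%nat ->
  (x l mod Z.abs m ^ Z.of_nat k = x k)%Z.
Proof.
  intros hm Hx. induction 1 as [|l Hl IH].
  - apply Z.mod_small, Hx.
  - destruct (Hx l) as [_ E]. rewrite <- IH, <- E.
    apply Znumtheory.Zmod_div_mod.
    + apply Z.pow_pos_nonneg; lia.
    + apply Z.pow_pos_nonneg; lia.
    + exists (Z.abs m ^ Z.of_nat (l - k))%Z. rewrite <- Z.pow_add_r by lia. f_equal. lia.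
Qed.

Lemma divide_of_mod_pow m z c k : (2 <= Z.abs m)%Z ->
  (z mod Z.abs m ^ Z.of_nat k = c)%Z -> (m ^ Z.of_nat k | z - c)%Z.
Proof.
  intros hm <-. apply Z.divide_abs_l. rewrite Z.abs_pow.
  exists (z / Z.abs m ^ Z.of_nat k)%Z.
  assert (0 < Z.abs m ^ Z.of_nat k)%Z by (apply Z.pow_pos_nonneg; lia).
  pose proof (Z.div_mod z (Z.abs m ^ Z.of_nat k)). lia.
Qed.

Lemma mod_pow_of_divide m z c k : (2 <= Z.abs m)%Z ->
  (m ^ Z.of_nat k | z - c)%Z -> (z mod Z.abs m ^ Z.of_nat k = c mod Z.abs m ^ Z.of_nat k)%Z.
Proof.
  intros hm H. apply mod_eq_of_divide.
  - assert (0 < Z.abs m ^ Z.of_nat k)%Z by (apply Z.pow_pos_nonneg; lia). lia.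
  - apply Z.divide_abs_l in H. now rewrite Z.abs_pow in H.
Qed.

Lemma madic_approx m x : (2 <= Z.abs m)%Z -> madic m x ->
  exists xi, Zabs_to_infty xi /\ madic_conv m xi x.
Proof.
  intros hm Hx. exists (fun n => x n + Z.abs m ^ Z.of_nat n)%Z. split.
  - intros M. exists (Z.to_nat M). intros n Hn. destruct (Hx n) as [H _].
    pose proof (Z.pow_gt_lin_r (Z.abs m) (Z.of_nat n) ltac:(lia) ltac:(lia)). lia.
  - intros k. exists k. intros n Hn.
    replace (x n + Z.abs m ^ Z.of_nat n)%Z
      with (x n + Z.abs m ^ Z.of_nat (n - k) * Z.abs m ^ Z.of_nat k)%Z.
    + rewrite Z.mod_add; [now apply madic_mod|].
      assert (0 < Z.abs m ^ Z.of_nat k)%Z by (apply Z.pow_pos_nonneg; lia). lia.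
    + rewrite <- Z.pow_add_r by lia. do 2 f_equal. lia.
Qed.

Lemma BSbar_approx m x N L k M : (2 <= Z.abs m)%Z -> madic m x -> BSbar m x N ->
  exists z, (M <= Z.abs z)%Z /\ (z mod Z.abs m ^ Z.of_nat k = x k)%Z /\
    forall w, reduced w = true -> (length w <= L)%nat -> (BS m z w <-> proj1_sig N w).
Proof.
  intros hm Hx HN. destruct (madic_approx m x hm Hx) as (xi & Hinf & Hconv).
  destruct (Hinf M) as [n1 H1]. destruct (Hconv k) as [n2 H2].
  destruct (HN xi Hinf Hconv (exp (- INR L)) (exp_pos _)) as [n3 H3].
  set (n := (n1 + n2 + n3)%nat). exists (xi n).
  split; [apply H1; unfold n; lia|]. split; [apply H2; unfold n; lia|].
  intros w Hw Hl. apply (mdist_lt_agree _ _ L); [apply H3; unfold n; lia|assumption|assumption].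
Qed.

(** Large integers approximating the two limits agree modulo $m^k$, so by [BS_stable] they have the
    same relations of length below $2k$. *)
Lemma BSbar_dist_le m x y N N' k : (2 <= Z.abs m)%Z -> madic m x -> madic m y ->
  BSbar m x N -> BSbar m y N' -> x k = y k ->
  G2dist N N' <= exp (- INR (2 * k)).
Proof.
  intros hm Hx Hy HN HN' E. apply mdist_le. intros w [Hw Hne].
  destruct (Nat.le_gt_cases (2 * k) (length w)) as [|Hl]; [assumption|].
  exfalso. apply Hne.
  destruct (BS_stable m k (x k) w hm Hw) as (b & M & Hb); [lia|].
  destruct (BSbar_approx m x N (2 * k) k M hm Hx HN) as (z & Hz1 & Hz2 & Hz3).
  destruct (BSbar_approx m y N' (2 * k) k M hm Hy HN') as (z' & Hz1' & Hz2' & Hz3').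
  rewrite <- Hz3, <- Hz3' by (assumption || lia).
  rewrite (Hb z), (Hb z'); [reflexivity|assumption| |assumption|].
  - rewrite E. now apply divide_of_mod_pow.
  - now apply divide_of_mod_pow.
Qed.

Lemma BSbar_dist_ge m x y N N' k : (2 <= Z.abs m)%Z -> madic m x -> madic m y ->
  madic_unit m x -> BSbar m x N -> BSbar m y N' -> x k <> y k ->
  exp (- INR (2 * (Z.abs_nat m + 1) * (k + 1) + 4)) <= G2dist N N'.
Proof.
  intros hm Hx Hy (u & Hu & Hxu) HN HN' Hne.
  set (L := (2 * (Z.abs_nat m + 1) * (k + 1) + 4)%nat).
  (* Precision $k+1$ rather than $k$ makes [z] inherit invertibility modulo [m] from [x], even for
     $k = 0$. *)
  destruct (BSbar_approx m x N L (S k) 4 hm Hx HN) as (z & Hz1 & Hz2 & Hz3).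
  destruct (BSbar_approx m y N' L k 4 hm Hy HN') as (z' & Hz1' & Hz2' & Hz3').
  assert (Hzk : (z mod Z.abs m ^ Z.of_nat k = x k)%Z).
  { destruct (Hx k) as [_ <-]. rewrite <- Hz2. apply Znumtheory.Zmod_div_mod.
    - apply Z.pow_pos_nonneg; lia.
    - apply Z.pow_pos_nonneg; lia.
    - exists (Z.abs m)%Z. rewrite Nat2Z.inj_succ, Z.pow_succ_r; lia. }
  destruct (BS_separate m z z' (u (S k)) k) as (w & Hw & Hlen & Hin & Hout);
    [assumption|assumption|assumption| | |].
  - pose proof (divide_of_mod_pow m z _ (S k) hm Hz2) as H1.
    pose proof (Hxu (S k)) as H2. 
    apply divide_of_mod_eq in H2; [|apply Z.pow_nonzero; lia].
    rewrite <- Z.abs_pow, Z.divide_abs_l in H2.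
    assert (Hp : (m | m ^ Z.of_nat (S k))%Z)
      by (rewrite Nat2Z.inj_succ, Z.pow_succ_r by lia; apply Z.divide_factor_l).
    apply (Z.divide_trans _ _ _ Hp) in H1, H2.
    replace (z * u (S k) - 1)%Z with ((z - x (S k)) * u (S k) + (x (S k) * u (S k) - 1))%Z by ring.
    apply Z.divide_add_r; [now apply Z.divide_mul_l|assumption].
  - intros H. apply mod_pow_of_divide in H; [|assumption]. congruence.
  - apply Rle_trans with (exp (- INR (length w))); [now apply exp_INR_le|].
    apply mdist_ge. split; [assumption|].
    rewrite <- Hz3, <- Hz3' by assumption. tauto.
Qed.

(** * Existence of the limit groups *)

Lemma eventually_bounded_length (P : word -> nat -> Prop) L :
  (forall w, exists n0, forall n, (n0 <= n)%nat -> P w n) ->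
  exists n0, forall n w, (n0 <= n)%nat -> (length w <= L)%nat -> P w n.
Proof.
  revert P. induction L as [|L IH]; intros P H.
  - destruct (H []) as [n0 H0]. exists n0. intros n [|l w] Hn Hl; [now apply H0|cbn in Hl; lia].
  (* The four possible first letters are absorbed into the predicate, so finiteness is used one
     letter at a time. *)
  - destruct (IH (fun w n => P [] n /\ forall l, P (l :: w) n)) as [n0 H0].
    + intros w. destruct (H []) as [n1 H1].
      destruct (H ((false, false) :: w)) as [n2 H2], (H ((false, true) :: w)) as [n3 H3],
        (H ((true, false) :: w)) as [n4 H4], (H ((true, true) :: w)) as [n5 H5].
      exists (n1 + n2 + n3 + n4 + n5)%nat. intros n Hn. split; [apply H1; lia|].
      intros [[] []]; [apply H5|apply H4|apply H3|apply H2]; lia.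
    + exists n0. intros n [|l w] Hn Hl.
      * now apply (H0 n [] Hn); cbn; lia.
      * cbn in Hl. apply (H0 n w Hn). lia.
Qed.

(** Quantifying over all large integers near [x], instead of along one sequence, makes this
    candidate for the limit independent of the sequence. *)
Definition limit_kernel (m : Z) (x : nat -> Z) (w : word) : Prop :=
  exists (M : Z) (k : nat), forall z, (M <= Z.abs z)%Z ->
    (z mod Z.abs m ^ Z.of_nat k = x k)%Z -> BS m z w.

Lemma madic_mod_le m x z k l : (2 <= Z.abs m)%Z -> madic m x -> (k <= l)%nat ->
  (z mod Z.abs m ^ Z.of_nat l = x l)%Z -> (z mod Z.abs m ^ Z.of_nat k = x k)%Z.
Proof.
  intros hm Hx Hkl Hz. rewrite <- (madic_mod m x k l), <- Hz by assumption.
  apply Znumtheory.Zmod_div_mod.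
  - apply Z.pow_pos_nonneg; lia.
  - apply Z.pow_pos_nonneg; lia.
  - exists (Z.abs m ^ Z.of_nat (l - k))%Z. rewrite <- Z.pow_add_r by lia. f_equal. lia.
Qed.

Lemma limit_kernel_normal m x : (2 <= Z.abs m)%Z -> madic m x ->
  IsNormalSub (limit_kernel m x).
Proof.
  intros hm Hx. split; [|split; [|split; [|split]]].
  - intros w (M & k & H). destruct (madic_approx m x hm Hx) as (xi & Hinf & Hconv).
    destruct (Hinf M) as [n1 H1], (Hconv k) as [n2 H2].
    apply (BS_reduced m (xi (n1 + n2)%nat)), H; [apply H1|apply H2]; lia.
  - exists 0%Z, 0%nat. intros. apply BS_normal.
  - intros u v (M & k & H) (M' & k' & H'). exists (Z.max M M'), (max k k').
    intros z Hz1 Hz2. apply BS_normal.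
    + apply H; [lia|]. now apply (madic_mod_le m x z k (max k k')); [| |lia|].
    + apply H'; [lia|]. now apply (madic_mod_le m x z k' (max k k')); [| |lia|].
  - intros u (M & k & H). exists M, k. intros z Hz1 Hz2. now apply BS_normal, H.
  - intros g u Hg (M & k & H). exists M, k. intros z Hz1 Hz2.
    apply BS_normal; [assumption|now apply H].
Qed.

(** By [BS_stable] membership of each word is eventually constant along any admissible sequence,
    with the value given by [limit_kernel]; uniformity over words of bounded length gives
    convergence. *)
Lemma BSbar_exists m x : (2 <= Z.abs m)%Z -> madic m x -> exists N, BSbar m x N.
Proof.
  intros hm Hx. exists (exist _ _ (limit_kernel_normal m x hm Hx)).
  intros xi Hinf Hconv eps Heps. cbn [proj1_sig].
  destruct (INR_unbounded (- ln eps)) as [L HL].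
  assert (HLe : exp (- INR L) < eps).
  { rewrite <- (exp_ln eps Heps). apply exp_increasing. lra. }
  destruct (eventually_bounded_length
    (fun w n => reduced w = true -> (BS m (xi n) w <-> limit_kernel m x w)) L) as [n0 Hn0].
  - intros w. destruct (reduced w) eqn:Hw; [|now exists 0%nat].
    destruct (BS_stable m (length w) (x (length w)) w hm Hw) as (b & M & Hb); [lia|].
    destruct (Hinf M) as [n1 H1].
    destruct (Hconv (length w)) as [n2 H2]. exists (n1 + n2)%nat. intros n Hn _.
    rewrite (Hb (xi n)); [|apply H1; lia|apply divide_of_mod_pow; [assumption|apply H2; lia]].
    split.
    + intros HB. exists M, (length w). intros z Hz1 Hz2. apply (Hb z); [assumption| |assumption].
      now apply divide_of_mod_pow.
    + intros (M' & k & H). destruct (Hinf M') as [n3 H3], (Hconv k) as [n4 H4].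
      set (n' := (n1 + n2 + n3 + n4)%nat).
      apply (Hb (xi n')).
      * apply H1; unfold n'; lia.
      * apply divide_of_mod_pow; [assumption|apply H2; unfold n'; lia].
      * apply H; [apply H3|apply H4]; unfold n'; lia.
  - exists n0. intros n Hn. apply Rle_lt_trans with (exp (- INR L)); [|assumption].
    apply mdist_le. intros w [Hw Hne].
    destruct (Nat.le_gt_cases L (length w)); [assumption|].
    exfalso. apply Hne. apply Hn0; [assumption|lia|assumption].
Qed.

(** * Upper bound on the dimension *)

Lemma choice_fun {A B} (P : A -> B -> Prop) :
  (forall a, exists b, P a b) -> exists f, forall a, P a (f a).
Proof.
  intros H. exists (fun a => proj1_sig (constructive_indefinite_description _ (H a))).
  intros a. apply proj2_sig.
Qed.

Section Diameter.
Context {X : Type} (d : X -> X -> R) (B : R) (d_bound : forall x y, d x y <= B).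

Lemma diam_cases (U : X -> Prop) :
  (~ (exists x, U x) /\ diam X d U = 0) \/
  is_lub (fun t => exists x y, U x /\ U y /\ t = d x y) (diam X d U).
Proof.
  unfold diam. apply epsilon_spec.
  destruct (classic (exists x, U x)) as [[x Hx]|H].
  - destruct (completeness (fun t => exists x y, U x /\ U y /\ t = d x y)) as [r Hr].
    + exists B. intros t (y & z & _ & _ & ->). apply d_bound.
    + now exists (d x x), x, x.
    + exists r. now right.
  - exists 0. now left.
Qed.

Lemma diam_le (U : X -> Prop) b : 0 <= b ->
  (forall x y, U x -> U y -> d x y <= b) -> diam X d U <= b.
Proof.
  intros Hb H. destruct (diam_cases U) as [[_ ->]|[_ Hlub]]; [assumption|].
  apply Hlub. intros t (x & y & Hx & Hy & ->). now apply H.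
Qed.

Lemma le_diam (U : X -> Prop) x y : U x -> U y -> d x y <= diam X d U.
Proof.
  intros Hx Hy. destruct (diam_cases U) as [[Hn _]|[Hub _]].
  - destruct Hn. now exists x.
  - apply Hub. now exists x, y.
Qed.

End Diameter.

Lemma powd_nonneg r s : 0 <= powd r s.
Proof.
  unfold powd. destruct (Req_EM_T r 0); [destruct (Req_EM_T s 0); lra|].
  left. apply exp_pos.
Qed.

Lemma cover_term_nonneg X d U s : 0 <= cover_term X d U s.
Proof.
  unfold cover_term. destruct (excluded_middle_informative _); [apply powd_nonneg|lra].
Qed.

Lemma powd_le_exp r s t : 0 < s -> 0 <= r <= exp t -> powd r s <= exp (s * t).
Proof.
  intros Hs [Hr1 Hr2]. unfold powd. destruct (Req_EM_T r 0).
  - destruct (Req_EM_T s 0); [lra|]. left. apply exp_pos.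
  - unfold Rpower. assert (Hln : ln r <= t).
    { rewrite <- (ln_exp t). destruct Hr2 as [Hr2| ->]; [|lra].
      left. apply ln_increasing; lra. }
    destruct Hln as [Hln| ->]; [|lra]. left. apply exp_increasing.
    now apply Rmult_lt_compat_l.
Qed.

Lemma sum_f_R0_le_support (f : nat -> R) K c n : 0 <= c ->
  (forall i, (i < K)%nat -> f i <= c) -> (forall i, (K <= i)%nat -> f i <= 0) ->
  sum_f_R0 f n <= INR K * c.
Proof.
  intros Hc H1 H2. apply Rle_trans with (INR (Nat.min (S n) K) * c).
  - induction n as [|n IH]; cbn [sum_f_R0].
    + destruct K as [|K].
      * specialize (H2 0%nat). cbn. apply Rle_trans with 0; [apply H2; lia|lra].
      * replace (Nat.min 1 (S K)) with 1%nat by lia. specialize (H1 0%nat).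
        cbn. rewrite Rmult_1_l. apply H1. lia.
    + destruct (Nat.lt_ge_cases (S n) K) as [H|H].
      * replace (Nat.min (S (S n)) K) with (S (Nat.min (S n) K)) by lia.
        rewrite S_INR. specialize (H1 (S n) H). lra.
      * replace (Nat.min (S (S n)) K) with (Nat.min (S n) K) by lia.
        specialize (H2 (S n) H). lra.
  - apply Rmult_le_compat_r; [assumption|]. apply le_INR. lia.
Qed.

(** The $|m|^k$ residue classes modulo $m^k$ have diameter at most $e^{-2k}$, so their total cost is
    at most $e^{k(\log|m| - 2s)}$, which tends to 0. *)
Lemma Zmx_null m s : (2 <= Z.abs m)%Z -> ln (IZR (Z.abs m)) / 2 < s ->
  Hnull G2 G2dist s (Zmx m).
Proof.
  intros hm Hs delta eps Hdelta Heps.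
  set (M := IZR (Z.abs m)) in *.
  assert (HM : 1 < M) by (unfold M; apply IZR_lt; lia).
  assert (HlnM : 0 < ln M) by (rewrite <- ln_1; apply ln_increasing; lra).
  (* The first bound makes the diameters at most [delta], the second makes the total cost at most
     [eps]. *)
  destruct (INR_unbounded (Rmax (- ln delta) (- ln eps / (2 * s - ln M)))) as [k Hk].
  apply Rgt_lt, Rmax_Rlt in Hk. destruct Hk as [Hk1 Hk2].
  assert (Hpow : (0 < Z.abs m ^ Z.of_nat k)%Z) by (apply Z.pow_pos_nonneg; lia).
  assert (Hk0 : 0 <= INR k) by apply pos_INR.
  set (U := fun (i : nat) (N : G2) => (Z.of_nat i < Z.abs m ^ Z.of_nat k)%Z /\
     exists x, madic m x /\ BSbar m x N /\ x k = Z.of_nat i).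
  assert (Hdiam : forall i, diam G2 G2dist (U i) <= exp (- INR (2 * k))).
  { intros i. apply (diam_le G2dist 1).
    - intros N N'. apply mdist_bounds.
    - left. apply exp_pos.
    - intros N N' (_ & x & Hx & HN & Ex) (_ & y & Hy & HN' & Ey).
      apply (BSbar_dist_le m x y); congruence || assumption. }
  exists U. split; [|split].
  - intros N (x & Hx & _ & HN). exists (Z.to_nat (x k)).
    pose proof (proj1 (Hx k)). split; [lia|]. exists x.
    repeat split; try assumption; try apply Hx. lia.
  - intros i. apply Rle_trans with (1 := Hdiam i).
    rewrite <- (exp_ln delta) by assumption. left. apply exp_increasing.
    rewrite mult_INR. cbn [INR]. lra.
  - intros n. set (c := exp (s * - INR (2 * k))).
    apply Rle_trans with (INR (Z.to_nat (Z.abs m ^ Z.of_nat k)) * c).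
    + apply sum_f_R0_le_support.
      * left. apply exp_pos.
      * intros i _. unfold cover_term.
        destruct (excluded_middle_informative _) as [[N HN]|]; [|left; apply exp_pos].
        apply powd_le_exp; [lra|]. split; [|apply Hdiam].
        apply Rle_trans with (G2dist N N); [apply mdist_bounds|].
        apply (le_diam G2dist 1); [|assumption|assumption].
        intros ? ?. apply mdist_bounds.
      * intros i Hi. unfold cover_term.
        destruct (excluded_middle_informative _) as [[N [HN _]]|]; [lia|lra].
    + rewrite INR_IZR_INZ, Z2Nat.id by lia. rewrite <- pow_IZR. fold M.
      rewrite <- Rpower_pow by lra. unfold Rpower, c. rewrite <- exp_plus.
      rewrite <- (exp_ln eps) by assumption. left. apply exp_increasing.
      rewrite mult_INR. cbn [INR].
      assert (Hp : 0 < 2 * s - ln M) by lra.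
      apply (Rmult_lt_compat_r _ _ _ Hp) in Hk2.
      replace (- ln eps / (2 * s - ln M) * (2 * s - ln M)) with (- ln eps) in Hk2 by (field; lra).
      lra.
Qed.

(** * Covers of the m-adic integers by residue classes *)

Lemma sum_f_R0_swap (f : nat -> nat -> R) m n :
  sum_f_R0 (fun i => sum_f_R0 (f i) n) m = sum_f_R0 (fun j => sum_f_R0 (fun i => f i j) m) n.
Proof.
  induction n as [|n IH]; [reflexivity|]. cbn [sum_f_R0].
  rewrite <- IH. rewrite <- sum_plus. reflexivity.
Qed.

Lemma sum_f_R0_mono (f : nat -> R) m n : (forall i, 0 <= f i) -> (m <= n)%nat ->
  sum_f_R0 f m <= sum_f_R0 f n.
Proof.
  intros Hf. induction 1 as [|n _ IH]; [lra|]. cbn [sum_f_R0]. specialize (Hf (S n)). lra.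
Qed.

Lemma term_le_sum_f_R0 (f : nat -> R) i : (forall j, 0 <= f j) -> f i <= sum_f_R0 f i.
Proof.
  intros Hf. destruct i as [|i]; cbn [sum_f_R0]; [lra|].
  pose proof (cond_pos_sum f i Hf). lra.
Qed.

Lemma sum_f_R0_indicator (P : nat -> bool) a n : 0 <= a ->
  (forall i j, P i = true -> P j = true -> i = j) ->
  sum_f_R0 (fun i => if P i then a else 0) n <= a /\
  ((forall i, (i <= n)%nat -> P i = false) ->
     sum_f_R0 (fun i => if P i then a else 0) n = 0).
Proof.
  intros Ha HP.
  assert (H0 : forall n, (forall i, (i <= n)%nat -> P i = false) ->
     sum_f_R0 (fun i => if P i then a else 0) n = 0).
  { clear n. induction n as [|n IH]; intros H; cbn [sum_f_R0].
    - now rewrite H by lia.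
    - rewrite IH by (intros; apply H; lia). rewrite H by lia. lra. }
  split; [|apply H0]. induction n as [|n IH]; cbn [sum_f_R0].
  - destruct (P 0%nat); lra.
  - destruct (P (S n)) eqn:E; [|lra]. rewrite H0; [lra|].
    intros i Hi. destruct (P i) eqn:Ei; [|reflexivity].
    specialize (HP i (S n) Ei E). lia.
Qed.

(* The normalised measure of the intersection of the residue classes of [c] modulo [q^k]
   and of [c'] modulo [q^k']. *)
Definition overlap (q : Z) (k' : nat) (c' : Z) (k : nat) (c : Z) : R :=
  if (k' <=? k)%nat
  then if (c mod q ^ Z.of_nat k' =? c')%Z then (/ IZR q) ^ k else 0
  else if (c' mod q ^ Z.of_nat k =? c)%Z then (/ IZR q) ^ k' else 0.

Lemma overlap_nonneg q k' c' k c : (2 <= q)%Z -> 0 <= overlap q k' c' k c.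
Proof.
  intros hq. assert (0 < / IZR q) by (apply Rinv_0_lt_compat, IZR_lt; lia).
  unfold overlap. destruct (_ <=? _)%nat; destruct (_ =? _)%Z; try lra;
    left; now apply pow_lt.
Qed.

(** The [q] classes modulo $q^{k+1}$ inside a class modulo $q^k$ partition it, and the measure is
    additive. *)
Lemma overlap_split q k' c' k c : (2 <= q)%Z -> (0 <= c < q ^ Z.of_nat k)%Z ->
  sum_f_R0 (fun d => overlap q k' c' (S k) (c + Z.of_nat d * q ^ Z.of_nat k)) (Z.to_nat q - 1)
  <= overlap q k' c' k c.
Proof.
  intros hq Hc.
  assert (Hw : 0 < / IZR q) by (apply Rinv_0_lt_compat, IZR_lt; lia).
  set (p := (q ^ Z.of_nat k)%Z) in *.
  assert (Hp : (q ^ Z.of_nat (S k) = q * p)%Z)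
    by (unfold p; rewrite Nat2Z.inj_succ, Z.pow_succ_r; lia).
  assert (Hinj : forall e i j, (c + Z.of_nat i * p =? e)%Z = true ->
             (c + Z.of_nat j * p =? e)%Z = true -> i = j).
  { intros e i j Hi Hj. apply Z.eqb_eq in Hi, Hj. nia. }
  assert (Hmod : forall e d, (c' mod q ^ Z.of_nat (S k) = e)%Z -> (c + Z.of_nat d * p = e)%Z ->
             (c' mod p = c)%Z).
  { intros e d He Hd. rewrite <- (Z.mod_small c p), <- (Z.mod_add c (Z.of_nat d)) by lia.
    rewrite Hd, <- He. apply Znumtheory.Zmod_div_mod; [lia|lia|].
    rewrite Hp. apply Z.divide_factor_r. }
  (* For $k' \le k$ all [q] subclasses contribute equally. Otherwise at most one of them meets the
     given class: it equals that class when $k' = k+1$ and contains it when $k'$ is larger. *)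
  destruct (Nat.lt_trichotomy k' (S k)) as [Hk|[Hk|Hk]].
  - unfold overlap. rewrite (proj2 (Nat.leb_le k' k)), (proj2 (Nat.leb_le k' (S k))) by lia.
    apply Req_le.
    transitivity (sum_f_R0 (fun _ => if (c mod q ^ Z.of_nat k' =? c')%Z
       then (/ IZR q) ^ S k else 0) (Z.to_nat q - 1)).
    + apply sum_eq. intros d _.
      replace p with (q ^ Z.of_nat (k - k') * q ^ Z.of_nat k')%Z
        by (unfold p; rewrite <- Z.pow_add_r by lia; f_equal; lia).
      rewrite Z.mul_assoc, Z.mod_add; [reflexivity|].
      apply Z.pow_nonzero; lia.
    + rewrite sum_cte. replace (S (Z.to_nat q - 1)) with (Z.to_nat q) by lia.
      rewrite INR_IZR_INZ, Z2Nat.id by lia.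
      destruct (_ =? _)%Z; [|lra]. cbn [pow]. field. apply not_0_IZR. lia.
  - subst k'. unfold overlap. rewrite Nat.leb_refl, (proj2 (Nat.leb_gt (S k) k)) by lia.
    destruct (sum_f_R0_indicator (fun d => (c + Z.of_nat d * p =? c')%Z)
      ((/ IZR q) ^ S k) (Z.to_nat q - 1)) as [H1 H2]; [left; now apply pow_lt|apply Hinj|].
    rewrite (sum_eq _ (fun d => if (c + Z.of_nat d * p =? c')%Z then (/ IZR q) ^ S k else 0)).
    2:{ intros d Hd. rewrite Z.mod_small; [reflexivity|]. rewrite Hp. nia. }
    fold p. destruct (Z.eqb_spec (c' mod p) c) as [E|E]; [assumption|].
    apply Req_le, H2. intros d Hd. apply Z.eqb_neq. intros Ed. apply E.
    rewrite <- Ed, Z.mod_add, Z.mod_small; lia.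
  - unfold overlap. rewrite !(proj2 (Nat.leb_gt _ _)) by lia.
    set (e := (c' mod q ^ Z.of_nat (S k))%Z).
    destruct (sum_f_R0_indicator (fun d => (c + Z.of_nat d * p =? e)%Z)
      ((/ IZR q) ^ k') (Z.to_nat q - 1)) as [H1 H2]; [left; now apply pow_lt|apply Hinj|].
    rewrite (sum_eq _ (fun d => if (c + Z.of_nat d * p =? e)%Z then (/ IZR q) ^ k' else 0))
      by (intros; now rewrite Z.eqb_sym).
    fold p. destruct (Z.eqb_spec (c' mod p) c) as [E|E]; [assumption|].
    apply Req_le, H2. intros d Hd. apply Z.eqb_neq. intros Ed. apply E.
    now apply (Hmod e d).
Qed.

(* A class is thin if the classes [c i] modulo [q^k i] cannot cover it for reasons
   of measure. *)
Definition thin (q : Z) (k : nat -> nat) (c : nat -> Z) (j : nat) (z : Z) : Prop :=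
  (0 <= z < q ^ Z.of_nat j)%Z /\ exists v, v < (/ IZR q) ^ j /\
  forall n, sum_f_R0 (fun i => overlap q (k i) (c i) j z) n <= v.

Lemma eventually_all (P : nat -> nat -> Prop) D :
  (forall d n n', (n <= n')%nat -> P d n -> P d n') ->
  (forall d, (d <= D)%nat -> exists n, P d n) -> exists n, forall d, (d <= D)%nat -> P d n.
Proof.
  intros Hmono. induction D as [|D IH]; intros H.
  - destruct (H 0%nat) as [n Hn]; [lia|]. exists n. intros d Hd. now replace d with 0%nat by lia.
  - destruct IH as [n Hn]; [intros; apply H; lia|]. destruct (H (S D)) as [n' Hn']; [lia|].
    exists (n + n')%nat. intros d Hd. destruct (Nat.eq_dec d (S D)) as [->|].
    + apply (Hmono _ n'); [lia|assumption].
    + apply (Hmono _ n); [lia|]. apply Hn. lia.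
Qed.

(** If no subclass were thin, each would have a partial sum above $v/q$; at a common large index
    these add up to more than $v$, against [overlap_split]. *)
Lemma thin_child q k c j z : (2 <= q)%Z -> thin q k c j z ->
  exists z', thin q k c (S j) z' /\ (z' mod q ^ Z.of_nat j = z)%Z.
Proof.
  intros hq [Hz (v & Hv & Hsum)].
  assert (Hq : 0 < IZR q) by (apply IZR_lt; lia).
  assert (Hw : 0 < / IZR q) by now apply Rinv_0_lt_compat.
  apply NNPP. intros Hno.
  set (S' := fun d n => sum_f_R0 (fun i => overlap q (k i) (c i) (S j)
                (z + Z.of_nat d * q ^ Z.of_nat j)) n).
  destruct (eventually_all (fun d n => v * / IZR q < S' d n) (Z.to_nat q - 1)) as [n Hn].
  - intros d n n' Hnn H. apply Rlt_le_trans with (1 := H). apply sum_f_R0_mono; [|assumption].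
    intros i. now apply overlap_nonneg.
  - intros d Hd. apply NNPP. intros Hnn. apply Hno.
    exists (z + Z.of_nat d * q ^ Z.of_nat j)%Z. split; [split|].
    + rewrite Nat2Z.inj_succ, Z.pow_succ_r by lia. nia.
    + exists (v * / IZR q). split.
      * cbn [pow]. rewrite (Rmult_comm (/ IZR q)). now apply Rmult_lt_compat_r.
      * intros n. apply Rnot_lt_le. intros H. apply Hnn. now exists n.
    + rewrite Z.mod_add, Z.mod_small; lia.
  - apply (Rlt_irrefl v). apply Rlt_le_trans with (2 := Hsum n).
    apply Rlt_le_trans with (sum_f_R0 (fun d => S' d n) (Z.to_nat q - 1)).
    + apply Rle_lt_trans with (sum_f_R0 (fun _ => v * / IZR q) (Z.to_nat q - 1)).
      * rewrite sum_cte. replace (S (Z.to_nat q - 1)) with (Z.to_nat q) by lia.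
        rewrite INR_IZR_INZ, Z2Nat.id by lia. apply Req_le. field. lra.
      * revert Hn. generalize (Z.to_nat q - 1)%nat. intros D Hn.
        induction D as [|D IH]; cbn [sum_f_R0]; [now apply Hn|].
        apply Rplus_lt_compat; [apply IH; intros; apply Hn; lia|now apply Hn].
    + unfold S'. rewrite sum_f_R0_swap. apply sum_Rle. intros i _. now apply overlap_split.
Qed.

(** The total measure is less than that of the class of 1 modulo $|m|$, so this class is thin, and
    thin subclasses can be chosen forever. Their intersection is a point outside every given
    class. *)
Lemma madic_uncovered m (k : nat -> nat) (c : nat -> Z) v : (2 <= Z.abs m)%Z ->
  v < / IZR (Z.abs m) -> (forall n, sum_f_R0 (fun i => (/ IZR (Z.abs m)) ^ k i) n <= v) ->
  exists x, madic m x /\ x 1%nat = 1%Z /\ forall i, x (k i) <> c i.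
Proof.
  intros hq Hv Hsum. set (q := Z.abs m) in *.
  assert (Hq : 1 < IZR q) by (apply IZR_lt; lia).
  assert (Hw : 0 < / IZR q) by (apply Rinv_0_lt_compat; lra).
  assert (Hw1 : / IZR q < 1) by (rewrite <- Rinv_1; apply Rinv_lt_contravar; lra).
  set (next := fun j z => epsilon (inhabits 0%Z)
     (fun z' => thin q k c (S j) z' /\ (z' mod q ^ Z.of_nat j = z)%Z)).
  set (s := fix s n := match n with O => 1%Z | S n => next (S n) (s n) end).
  assert (Hthin : forall n, thin q k c (S n) (s n)).
  { induction n as [|n IH].
    - split; [cbn; lia|]. exists v. split; [lra|]. intros n.
      apply Rle_trans with (2 := Hsum n). apply sum_Rle. intros i _. unfold overlap.
      destruct (Nat.leb_spec (k i) 1) as [Hk|Hk].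
      + assert (H1 : (/ IZR q) ^ 1 <= (/ IZR q) ^ k i).
        { destruct (k i) as [|[|]]; cbn; lra || lia. }
        destruct (_ =? _)%Z; [assumption|]. left. now apply pow_lt.
      + destruct (_ =? _)%Z; [lra|]. left. now apply pow_lt.
    - apply (epsilon_spec (inhabits 0%Z) _ (thin_child q k c (S n) (s n) hq IH)). }
  assert (Hmod : forall n, (s (S n) mod q ^ Z.of_nat (S n) = s n)%Z).
  { intros n. apply (epsilon_spec (inhabits 0%Z) _ (thin_child q k c (S n) (s n) hq (Hthin n))). }
  exists (fun n => match n with O => 0%Z | S n => s n end). split; [|split].
  - intros [|n].
    + cbn. split; [lia|]. reflexivity.
    + split; [apply Hthin|]. apply Hmod.
  - reflexivity.
  (* The chain starts at level 1, so [s (k i)] lives at level $k_i + 1$. If the point lay in class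
     $i$, that class would contain this whole subclass, and the single term $i$ would already have
     its full measure. *)
  - intros i Hi. destruct (Hthin (k i)) as [_ (v' & Hv' & Hs)].
    apply (Rlt_irrefl v'). apply Rlt_le_trans with (1 := Hv').
    apply Rle_trans with (2 := Hs i).
    apply Rle_trans with (2 := term_le_sum_f_R0 _ i (fun i => overlap_nonneg q (k i) (c i) _ _ hq)).
    unfold overlap. rewrite (proj2 (Nat.leb_le _ _)) by lia.
    rewrite (proj2 (Z.eqb_eq _ _)); [lra|].
    rewrite <- Hi. destruct (k i) as [|n]; [apply Z.mod_1_r|apply Hmod].
Qed.

(** * Invertibility of the elements congruent to 1 *)

Lemma inverse_mod_pow q z k : (q | z - 1)%Z -> exists u, (q ^ Z.of_nat k | z * u - 1)%Z.
Proof.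
  intros [r Hr]. induction k as [|k [u [t Ht]]].
  - exists 0%Z. apply Z.divide_1_l.
  (* With $zu = 1 + tq^k$ and $z = 1 + rq$, the new error is $tq^k(1 - z) = -trq^{k+1}$. *)
  - exists (u - t * q ^ Z.of_nat k)%Z. exists (- t * r)%Z.
    rewrite Nat2Z.inj_succ, Z.pow_succ_r by lia.
    replace z with (1 + r * q)%Z in * by lia. lia.
Qed.

Lemma madic_unit_of_one m x : (2 <= Z.abs m)%Z -> madic m x -> x 1%nat = 1%Z -> madic_unit m x.
Proof.
  intros hm Hx H1. set (q := Z.abs m) in *.
  assert (Hpos : forall k, (0 < q ^ Z.of_nat k)%Z) by (intros; apply Z.pow_pos_nonneg; lia).
  assert (Hinv : forall k, exists u, (q ^ Z.of_nat k | x k * u - 1)%Z).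
  { intros [|k]; [exists 0%Z; apply Z.divide_1_l|]. apply inverse_mod_pow.
    pose proof (madic_mod m x 1 (S k) hm Hx ltac:(lia)) as E. fold q in E.
    rewrite H1, Z.pow_1_r in E. exists (x (S k) / q)%Z.
    pose proof (Z.div_mod (x (S k)) q ltac:(lia)). lia. }
  (* The inverses are chosen independently at each level; uniqueness of inverses modulo $q^k$ makes
     them compatible. *)
  destruct (choice_fun _ Hinv) as [u Hu].
  exists (fun k => (u k mod q ^ Z.of_nat k)%Z). fold q. split.
  - intros k. fold q. split; [apply Z.mod_pos_bound, Hpos|].
    rewrite <- Znumtheory.Zmod_div_mod; [|apply Hpos|apply Hpos|].
    + apply mod_eq_of_divide; [specialize (Hpos k); lia|].
      assert (Hdiv : (q ^ Z.of_nat k | x (S k) * u (S k) - 1)%Z).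
      { apply (Z.divide_trans _ (q ^ Z.of_nat (S k))); [|apply Hu].
        exists q. rewrite Nat2Z.inj_succ, Z.pow_succ_r; lia. }
      assert (Hxx : (q ^ Z.of_nat k | x (S k) - x k)%Z).
      { pose proof (proj2 (Hx k)) as E. fold q in E.
        exists (x (S k) / q ^ Z.of_nat k)%Z.
        pose proof (Z.div_mod (x (S k)) (q ^ Z.of_nat k) ltac:(specialize (Hpos k); lia)). lia. }
      replace (u (S k) - u k)%Z with
        (u k * (x (S k) * u (S k) - 1) - u k * u (S k) * (x (S k) - x k)
          - u (S k) * (x k * u k - 1))%Z by ring.
      apply Z.divide_sub_r; [apply Z.divide_sub_r|]; apply Z.divide_mul_r; auto.
    + exists q. rewrite Nat2Z.inj_succ, Z.pow_succ_r; lia.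
  - intros k. fold q. rewrite Z.mul_mod_idemp_r by (specialize (Hpos k); lia).
    apply mod_eq_of_divide; [specialize (Hpos k); lia|]. apply Hu.
Qed.

(** * Lower bound on the dimension *)

(* The lower bound of [BSbar_dist_ge]. *)
Definition gap (m : Z) (k : nat) : R := exp (- INR (2 * (Z.abs_nat m + 1) * (k + 1) + 4)).

Lemma INR_abs_nat m : INR (Z.abs_nat m) = IZR (Z.abs m).
Proof. now rewrite INR_IZR_INZ, Zabs2Nat.id_abs. Qed.

(* A set of diameter 0 costs nothing in the cover; the [delta] pays for enclosing it
   in a residue class. *)
Lemma cover_class_index m s U delta : (2 <= Z.abs m)%Z -> 0 <= s ->
  s * (2 * (IZR (Z.abs m) + 1)) <= ln (IZR (Z.abs m)) -> 0 < delta ->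
  diam G2 G2dist U < gap m 0 ->
  exists k, diam G2 G2dist U < gap m k /\
    (/ IZR (Z.abs m)) ^ k
    <= exp (s * (4 * (IZR (Z.abs m) + 1) + 4)) * cover_term G2 G2dist U s + delta.
Proof.
  intros hm Hs Hsm Hdelta Hdiam. set (M := IZR (Z.abs m)) in *.
  set (C := exp (s * (4 * (M + 1) + 4))).
  assert (HM : 2 <= M) by (apply IZR_le; lia).
  assert (HC : 0 < C) by apply exp_pos.
  destruct (Rle_lt_dec (diam G2 G2dist U) 0) as [H0|H0].
  - destruct (pow_lt_1_zero (/ M)) with (y := delta) as [k Hk]; [|assumption|].
    { rewrite Rabs_pos_eq by (left; apply Rinv_0_lt_compat; lra).
      rewrite <- Rinv_1. apply Rinv_lt_contravar; lra. }
    exists k. split.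
    + apply Rle_lt_trans with (1 := H0), exp_pos.
    + specialize (Hk k (le_n k)). apply Rabs_def2 in Hk.
      pose proof (Rmult_le_pos _ _ (Rlt_le _ _ HC) (cover_term_nonneg G2 G2dist U s)). lra.
  - destruct (INR_unbounded (- ln (diam G2 G2dist U))) as [K HK].
    (* Some level fails because [gap m K] is at most $e^{-K}$, which is below the diameter. Level 0
       holds by hypothesis, so the level just before the first failure serves as [k]. *)
    destruct (first_failure (fun k => diam G2 G2dist U < gap m k) (S K)) as [H|(j & _ & Hj & Hlt)].
    { exfalso. specialize (H K (Nat.lt_succ_diag_r K)).
      apply (Rlt_irrefl (diam G2 G2dist U)). apply Rlt_trans with (1 := H).
      apply Rle_lt_trans with (exp (- INR K)); [apply exp_INR_le; nia|].
      rewrite <- (exp_ln (diam G2 G2dist U)) by assumption. apply exp_increasing. lra. }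
    destruct j as [|k]; [contradiction|]. exists k. split; [apply Hlt; lia|].
    apply Rnot_lt_le in Hj.
    assert (HU : exists N, U N).
    { apply NNPP. intros Hn. destruct (diam_cases G2dist 1) with (U := U) as [[_ E]|[_ Hl]].
      - intros ? ?. apply mdist_bounds.
      - lra.
      - apply (Rlt_irrefl 0). apply Rlt_le_trans with (1 := H0). apply Hl.
        intros t (N & _ & HN & _). destruct Hn. now exists N. }
    assert (Hct : cover_term G2 G2dist U s = exp (s * ln (diam G2 G2dist U))).
    { unfold cover_term. destruct (excluded_middle_informative _); [|contradiction].
      unfold powd. destruct (Req_EM_T (diam G2 G2dist U) 0); [lra|reflexivity]. }
    rewrite Hct. unfold C. rewrite <- exp_plus.
    assert (HMk : (/ M) ^ k = exp (- (INR k * ln M))).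
    { rewrite pow_inv, <- Rpower_pow, exp_Ropp by lra. reflexivity. }
    rewrite HMk. apply Rle_trans with (2 := Rplus_le_compat_l _ 0 _ (Rlt_le _ _ Hdelta)).
    rewrite Rplus_0_r.
    (* The part independent of [k], $4(M+1) + 4$, is absorbed by the constant $C$. The part
       $2(M+1)k$, times $s$, is at most $k \log M$ by the hypothesis on $s$. *)
    assert (Hln : - (2 * (M + 1) * (INR k + 2) + 4) <= ln (diam G2 G2dist U)).
    { assert (E : - (2 * (M + 1) * (INR k + 2) + 4) = ln (gap m (S k))).
      { unfold gap. rewrite ln_exp, !plus_INR, !mult_INR, !plus_INR, INR_abs_nat, !S_INR.
        fold M. cbn [INR]. ring. }
      rewrite E. destruct Hj as [Hj| ->]; [|lra].
      left. apply ln_increasing; [apply exp_pos|assumption]. }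
    assert (Hfin : - (INR k * ln M) <= s * (4 * (M + 1) + 4) + s * ln (diam G2 G2dist U)).
    { pose proof (Rmult_le_compat_l _ _ _ Hs Hln) as H1.
      pose proof (Rmult_le_compat_l _ _ _ (pos_INR k) Hsm) as H2. nra. }
    destruct Hfin as [Hfin| ->]; [|lra]. left. now apply exp_increasing.
Qed.

(** Different residues would put two points of [U] at distance at least [gap m k]. If [U] misses the
    set, the residue is arbitrary. *)
Lemma cover_class m U k : (2 <= Z.abs m)%Z -> diam G2 G2dist U < gap m k ->
  exists c, forall x N, madic m x -> madic_unit m x -> BSbar m x N -> U N -> x k = c.
Proof.
  intros hm Hdiam.
  destruct (classic (exists x N, madic m x /\ madic_unit m x /\ BSbar m x N /\ U N))
    as [(x0 & N0 & Hx0 & Hu0 & HN0 & HU0)|Hn].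
  - exists (x0 k). intros x N Hx Hu HN HU. apply NNPP. intros Hne.
    pose proof (BSbar_dist_ge m x x0 N N0 k hm Hx Hx0 Hu HN HN0 Hne) as H.
    assert (H' : G2dist N N0 <= diam G2 G2dist U).
    { apply (le_diam G2dist 1); [|assumption|assumption]. intros ? ?. apply mdist_bounds. }
    unfold gap in Hdiam. lra.
  - exists 0%Z. intros x N Hx Hu HN HU. destruct Hn. now exists x, N.
Qed.

Lemma sum_half_pow n : sum_f_R0 (fun i => (/ 2) ^ i) n <= 2.
Proof.
  assert (H : sum_f_R0 (fun i => (/ 2) ^ i) n = 2 - (/ 2) ^ n).
  { induction n as [|n IH]; cbn [sum_f_R0]; [cbn; lra|]. rewrite IH. cbn [pow]. lra. }
  rewrite H. pose proof (pow_lt (/ 2) n). lra.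
Qed.

(** A mass distribution argument: a cheap cover would yield residue classes of total measure below
    $1/|m|$, and [madic_uncovered] finds a unit congruent to 1 whose limit group escapes the
    cover. *)
Lemma Zmx_not_null m s : (2 <= Z.abs m)%Z -> 0 <= s ->
  s * (2 * (IZR (Z.abs m) + 1)) <= ln (IZR (Z.abs m)) -> ~ Hnull G2 G2dist s (Zmx m).
Proof.
  intros hm Hs Hsm Hnull. set (M := IZR (Z.abs m)) in *.
  set (C := exp (s * (4 * (M + 1) + 4))).
  assert (HM : 2 <= M) by (apply IZR_le; lia).
  assert (HC : 0 < C) by apply exp_pos.
  assert (Hw : 0 < / M) by (apply Rinv_0_lt_compat; lra).
  assert (Hg : 0 < gap m 0) by apply exp_pos.
  (* Half of [gap m 0] gives the strict inequality needed at level 0. The cost contributes at most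
     $1/(4M)$ after multiplication by [C], and the corrections $2^{-i}/(4M)$ at most $1/(2M)$, in
     total $3/(4M)$. *)
  destruct (Hnull (gap m 0 / 2) (/ M / 4 / C)) as (U & Hcov & Hdiam & Hsum).
  - lra.
  - repeat apply Rdiv_lt_0_compat; lra.
  - assert (Hk : forall i, exists k, diam G2 G2dist (U i) < gap m k /\
       (/ M) ^ k <= C * cover_term G2 G2dist (U i) s + (/ M / 4) * (/ 2) ^ i).
    { intros i. apply cover_class_index; [assumption|assumption|assumption| |].
      - apply Rmult_lt_0_compat; [lra|]. apply pow_lt. lra.
      - specialize (Hdiam i). lra. }
    apply choice_fun in Hk. destruct Hk as [k Hk].
    destruct (choice_fun _ (fun i => cover_class m (U i) (k i) hm (proj1 (Hk i)))) as [c Hc].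
    destruct (madic_uncovered m k c (3 / 4 * / M) hm) as (x & Hx & Hx1 & Hxk).
    + fold M. lra.
    + intros n. fold M.
      apply Rle_trans with (sum_f_R0 (fun i => C * cover_term G2 G2dist (U i) s
                                         + (/ M / 4) * (/ 2) ^ i) n).
      { apply sum_Rle. intros i _. apply Hk. }
      rewrite sum_plus.
      rewrite (sum_eq _ (fun i => cover_term G2 G2dist (U i) s * C)) by (intros; ring).
      rewrite (sum_eq (fun i => / M / 4 * _) (fun i => (/ 2) ^ i * (/ M / 4))) by (intros; ring).
      rewrite <- !scal_sum.
      pose proof (Rmult_le_compat_l C _ _ (Rlt_le _ _ HC) (Hsum n)) as H1.
      replace (C * (/ M / 4 / C)) with (/ M / 4) in H1 by (field; lra).
      pose proof (Rmult_le_compat_l (/ M / 4) _ _ ltac:(lra) (sum_half_pow n)).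
      change (pow (/ 2)) with (fun i => (/ 2) ^ i). lra.
    + pose proof (madic_unit_of_one m x hm Hx Hx1) as Hu.
      destruct (BSbar_exists m x hm Hx) as [N HN].
      destruct (Hcov N) as [i Hi]; [now exists x|].
      apply (Hxk i). now apply (Hc i x N).
Qed.

Theorem theorem6p6 (m : Z) (hm : (2 <= Z.abs m)%Z) :
  exists D : R, HausdorffDim G2 G2dist (Zmx m) D /\
    ln (IZR (Z.abs m)) / (2 * (IZR (Z.abs m) + 1)) <= D /\
    D <= ln (IZR (Z.abs m)) / 2.
Proof.
  set (M := IZR (Z.abs m)).
  assert (HM : 2 <= M) by (apply IZR_le; lia).
  assert (HlnM : 0 < ln M) by (rewrite <- ln_1; apply ln_increasing; lra).
  assert (Hlow : forall s, 0 <= s -> Hnull G2 G2dist s (Zmx m) -> ln M / (2 * (M + 1)) <= s).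
  { intros s Hs Hn. apply Rnot_lt_le. intros Hlt.
    apply (Zmx_not_null m s hm Hs); [fold M|assumption].
    apply (Rmult_lt_compat_r (2 * (M + 1))) in Hlt; [|lra].
    replace (ln M / (2 * (M + 1)) * (2 * (M + 1))) with (ln M) in Hlt by (field; lra). lra. }
  assert (Hup : forall s, ln M / 2 < s -> Hnull G2 G2dist s (Zmx m))
    by (intros; now apply Zmx_null).
  (* The dimension is the infimum of the null exponents, obtained as minus the supremum of their
     negatives. *)
  destruct (completeness (fun t => exists s, 0 <= s /\ Hnull G2 G2dist s (Zmx m) /\ t = - s))
    as [D' [Hub Hlub]].
  - exists (- (ln M / (2 * (M + 1)))). intros t (s & Hs & Hn & ->).
    apply Ropp_le_contravar. now apply Hlow.
  - exists (- (ln M / 2 + 1)), (ln M / 2 + 1).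
    split; [lra|]. split; [apply Hup; lra|reflexivity].
  - assert (HD : forall s, 0 <= s -> Hnull G2 G2dist s (Zmx m) -> - D' <= s).
    { intros s Hs Hn. assert (- s <= D') by (apply Hub; now exists s). lra. }
    assert (Hglb : forall b, (forall s, 0 <= s -> Hnull G2 G2dist s (Zmx m) -> b <= s) ->
              b <= - D').
    { intros b Hb. assert (D' <= - b); [|lra]. apply Hlub.
      intros t (s & Hs & Hn & ->). specialize (Hb s Hs Hn). lra. }
    exists (- D'). split; [now split|]. split; [now apply Hglb|].
    apply Rnot_lt_le. intros Hlt.
    pose proof (HD ((ln M / 2 + - D') / 2) ltac:(lra) ltac:(apply Hup; lra)). lra.
Qed.
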